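(* Let $k,n\ge 1$ be integers, let $z_1,\dots,z_n$ be distinct nonzero points of the open unit disk $\mathbb D$, and let $W_1,\dots,W_n\in\mathbb C^{k\times k}$. There exists a function $S\in(\mathcal S_1)^{k\times k}$ with $S(z_j)=W_j$ for $j=1,\dots,n$ if and only if there exists a $k\times k$ complex matrix $X$ such that the matrix $$\mathbb P_X=\begin{bmatrix}\mathbb P&E-WX^*&Z(E-WX^* )&0&0\\ E^*-XW^*&I_k&0&X&0\\ (E^*-XW^* )Z^*&0&I_k&0&X\\ 0&X^*&0&I_k&0\\ 0&0&X^*&0&I_k\end{bmatrix}$$ is positive semidefinite.
   Context: $\mathbb D=\{\lambda\in\mathbb C:|\lambda|<1\}$. $(\mathcal S_1)^{k\times k}$ is the set of bounded holomorphic $k\times k$ matrix-valued functions $S$ on $\mathbb D$ with $\|S\|_\infty=\sup_{z\in\mathbb D}\|S(z)\|\le 1$ (operator norm) and $S'(0)=0$. The matrices built from the data are $$\mathbb P=\left[\frac{I_k-W_iW_j^*}{1-z_i\overline{z_j}}\right]_{i,j=1}^n,\quad Z=\begin{bmatrix}z_1I_k&&\\&\ddots&\\&&z_nI_k\end{bmatrix},\quad E=\begin{bmatrix}I_k\\ \vdots\\ I_k\end{bmatrix},\quad W=\begin{bmatrix}W_1\\ \vdots\\ W_n\end{bmatrix},$$ where $\mathbb P$ and $Z$ are $nk\times nk$ and $E,W$ are $nk\times k$. *)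

(* Defs.v *)
From HB Require Import structures.
From mathcomp Require Import all_boot all_order all_algebra.
From mathcomp Require Import complex.
From mathcomp Require Import all_classical reals ereal topology normedtype.
From mathcomp Require Import derive.

Set Implicit Arguments.
Unset Strict Implicit.
Unset Printing Implicit Defensive.

Import Order.TTheory GRing.Theory Num.Theory.
Import numFieldNormedType.Exports.

Local Open Scope classical_set_scope.
Local Open Scope ring_scope.
Local Open Scope sesquilinear_scope.

(* For a complex matrix [A], [A ^t*] is the conjugate transpose [A^*]; for a
   scalar [c], [c^*] is the complex conjugate. *)

Definition unit_disk (R : realType) : set R[i] := [set z | `|z| < 1].

(* The modulus [`|c|] lives in [R[i]]; its real part is the modulus in [R]. *)
Definition enorm (R : realType) (k : nat) (x : 'cV[R[i]]_k) : R :=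
  Num.sqrt (\sum_(i < k) (complex.Re `|x i 0|) ^+ 2).

Definition opnorm (R : realType) (k : nat) (A : 'M[R[i]]_k) : R :=
  sup [set enorm (A *m x) | x in [set x | enorm x <= 1]].

(* Extended-real valued, so that an unbounded function gets norm [+oo] (the
   real-valued [sup] of an unbounded set would be [0]). *)
Definition disk_supnorm (R : realType) (k : nat) (S : R[i] -> 'M[R[i]]_k) :
    \bar R :=
  ereal_sup [set (opnorm (S z))%:E | z in @unit_disk R].

(* The regular module [R[i]^o] carries the normed space structure of [R[i]]
   over itself, so [derivable] is complex differentiability. Functions on the
   disk are total functions on [R[i]] of which only the values on the disk
   are constrained. *)
Definition holomorphic_on_disk (R : realType) (k : nat)
    (S : R[i] -> 'M[R[i]]_k) : Prop :=
  forall z, unit_disk z -> derivable (S : R[i]^o -> 'M[R[i]]_k) z 1.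

(* The class (S_1)^{k x k}; boundedness follows from the norm bound. *)
Definition schur_class1 (R : realType) (k : nat) (S : R[i] -> 'M[R[i]]_k) :
    Prop :=
  [/\ holomorphic_on_disk S,
      (disk_supnorm S <= 1%:E)%E
    & derive1 (S : R[i]^o -> 'M[R[i]]_k) 0 = 0].

Definition possemidef (R : realType) (m : nat) (A : 'M[R[i]]_m) : Prop :=
  A \is hermsymmx /\ forall x : 'cV[R[i]]_m, 0 <= (x ^t* *m A *m x) 0 0.

Section BlockMatrices.
Variables (R : realType) (k n : nat).
Variables (z : 'I_n -> R[i]) (W : 'I_n -> 'M[R[i]]_k).

(* The size [nk] appears as [\sum_(i < n) k], the size of an n-block matrix. *)

Definition pick_mx : 'M[R[i]]_(\sum_(i < n) k, \sum_(j < n) k) :=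
  \mxblock_(i < n, j < n)
    ((1 - z i * (z j)^*)^-1 *: (1%:M - W i *m (W j) ^t*)).

Definition Zmx : 'M[R[i]]_(\sum_(i < n) k) := \mxdiag_(i < n) ((z i)%:M : 'M_k).

Definition Emx : 'M[R[i]]_(\sum_(i < n) k, k) := \mxcol_(i < n) (1%:M : 'M_k).

Definition Wmx : 'M[R[i]]_(\sum_(i < n) k, k) := \mxcol_(i < n) W i.

Definition row_mx5 (m m1 m2 m3 m4 m5 : nat)
    (A1 : 'M[R[i]]_(m, m1)) (A2 : 'M[R[i]]_(m, m2)) (A3 : 'M[R[i]]_(m, m3))
    (A4 : 'M[R[i]]_(m, m4)) (A5 : 'M[R[i]]_(m, m5)) :
    'M[R[i]]_(m, m1 + (m2 + (m3 + (m4 + m5)))) :=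
  row_mx A1 (row_mx A2 (row_mx A3 (row_mx A4 A5))).

Definition pick_ext_mx (X : 'M[R[i]]_k) :
    'M[R[i]]_(\sum_(i < n) k + (k + (k + (k + k)))) :=
  let P := pick_mx in let Z := Zmx in let E := Emx in let W := Wmx in
  let I := 1%:M : 'M[R[i]]_k in
  col_mx (row_mx5 P (E - W *m X ^t*) (Z *m (E - W *m X ^t*)) 0 0)
 (col_mx (row_mx5 (E ^t* - X *m W ^t*) I 0 X 0)
 (col_mx (row_mx5 ((E ^t* - X *m W ^t*) *m Z ^t*) 0 I 0 X)
 (col_mx (row_mx5 0 (X ^t*) 0 I 0)
         (row_mx5 0 0 (X ^t*) 0 I)))).

End BlockMatrices.

(* Main.v *)
(* Put X = S(0). Eliminating the two trailing identity blocks, P_X >= 0 says that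
   the Pick matrix of the interpolation conditions S(z_j) = W_j, S(0) = X,
   S'(0) = 0 is positive semidefinite.

   Necessity: Goursat's theorem in logarithmic polar coordinates gives Cauchy's
   formula on the unit circle for merely complex differentiable functions, hence
   Szego kernels reproducing the values at z_j and 0 and the derivative at 0.
   If S is contractive, then for h a combination of kernels and u the same
   combination twisted by the adjoint values of S, the mean of |h - S u|^2 is
   bounded by |h|^2 - |u|^2, which is the quadratic form of the Pick matrix.

   Sufficiency: a Gram factorization P_X = G G^* yields rows H_j, H_0, H_0' for
   which (z_j H_j, 1), (0, 1), (H_0, 0) and (H_j, W_j), (H_0, X), (H_0', 0) have
   the same Gram matrix. A contraction [A B; C D] mapping the former to the
   latter has the transfer function S(z) = D + z C (1 - z A)^-1 B, which
   interpolates; moreover C B = H_0 B = 0, that is, S'(0) = 0. *)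

Require Import Defs.
From HB Require Import structures.
From mathcomp Require Import all_boot all_order all_algebra.
From mathcomp Require Import complex.
From mathcomp Require Import all_classical reals ereal topology normedtype.
From mathcomp Require Import derive.
From mathcomp Require Import sequences exp trigo measure lebesgue_measure.
From mathcomp Require Import lebesgue_integral.
From mathcomp Require Import ring lra.

Set Implicit Arguments.
Unset Strict Implicit.
Unset Printing Implicit Defensive.

Import Order.TTheory GRing.Theory Num.Theory.
Import numFieldNormedType.Exports.
Import ComplexField.

Local Open Scope classical_set_scope.
Local Open Scope ring_scope.
Local Open Scope sesquilinear_scope.

(** * The modulus and limits of complex functions *)

(** Only pointwise differentiability of S on the open disk is given: no continuity of S', and
    nothing on the boundary circle. The first gap forces Goursat's bisection. The second is bridged
    by dilation: for s > 1 near 1, S(u/s) is differentiable on the closed disk and takes the value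
    S(z_j) at s z_j, so only the kernels depend on s.

    The condition S'(0) = 0 enters through (S f)'(0) = S(0) f'(0). It makes the representer of f'(0)
    behave like that of a point evaluation: the adjoint of multiplication by S acts on it by S(0)^*,
    with no coupling to the representer of f(0). This is why the single unknown X serves two rows of
    the Pick matrix.

    In the converse direction everything is finite dimensional: the contraction is a square matrix
    acting on rows from the right, fixed on the row space of the first family and extended by zero
    on its orthogonal complement. The state space has the dimension of the Gram factor G. *)

Section ComplexTopology.
Variable R : realType.
Local Notation C := (R[i]^o).
Implicit Types (z w : R[i]).

Definition cabs (z : R[i]) : R := Normc.normc z.

Lemma cabsE z : `|z| = (cabs z)%:C%C.
Proof. by []. Qed.

Lemma ltc_norm z (e : R) : (`|z| < e%:C%C) = (cabs z < e).
Proof. by rewrite cabsE ltcR. Qed.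

Lemma lec_norm z (e : R) : (`|z| <= e%:C%C) = (cabs z <= e).
Proof. by rewrite cabsE lecR. Qed.

Lemma cabs_ge0 z : 0 <= cabs z.
Proof. by rewrite -lecR -cabsE normr_ge0. Qed.

Lemma cabsM z w : cabs (z * w) = cabs z * cabs w.
Proof. exact: Normc.normcM. Qed.

Lemma cabsD z w : cabs (z + w) <= cabs z + cabs w.
Proof. exact: le_normcD. Qed.

Lemma cabsN z : cabs (- z) = cabs z.
Proof. exact: normcN. Qed.

Lemma cabs_real (a : R) : cabs a%:C%C = `|a|.
Proof. by rewrite /cabs/= expr0n/= addr0 sqrtr_sqr. Qed.

Lemma cabs_i : cabs 'i%C = 1.
Proof. by rewrite /cabs /= expr0n add0r expr1n sqrtr1. Qed.

Lemma cabs_Re z : `|complex.Re z| <= cabs z.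
Proof. by rewrite -lecR -cabsE normc_ge_Re. Qed.

Lemma cabs_Im z : `|complex.Im z| <= cabs z.
Proof.
have -> : complex.Im z = complex.Re (- 'i%C * z).
  by case: z => a b /=; ring.
by apply: le_trans (cabs_Re _) _; rewrite cabsM cabsN cabs_i mul1r.
Qed.

Lemma cabs_le_ReIm z : cabs z <= `|complex.Re z| + `|complex.Im z|.
Proof.
case: z => a b /=.
rewrite -[leRHS]ger0_norm ?addr_ge0// -sqrtr_sqr ler_wsqrtr//.
by rewrite sqrrD !real_normK ?num_real// lerD2r lerDl mulrn_wge0// mulr_ge0.
Qed.

(** Norms on [R[i]^o] take values in [R[i]], so epsilons in limits are complex numbers; a positive
    one is real, which lets every estimate be carried out in [R]. *)
Lemma complex_gt0P (e : R[i]) : 0 < e -> exists2 d : R, 0 < d & e = d%:C%C.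
Proof.
by case: e => a b; rewrite ltcE/= => /andP[/eqP -> a0]; exists a.
Qed.

Lemma cvg_cabsP T (F : set_system T) (FF : Filter F) (f : T -> C) (l : C) :
  f @ F --> l <-> forall e : R, 0 < e -> \forall t \near F, cabs (l - f t) < e.
Proof.
split=> [/cvgrPdist_lt h e e0|h].
  have := h (e%:C%C); rewrite ltcR => /(_ e0).
  by apply: filterS => t; rewrite ltc_norm.
apply/cvgrPdist_lt => e /complex_gt0P[d d0 ->].
by apply: filterS (h d d0) => t; rewrite ltc_norm.
Qed.

Lemma Re_cvg T (F : set_system T) (FF : Filter F) (f : T -> C) (l : C) :
  f @ F --> l -> (fun t => complex.Re (f t)) @ F --> complex.Re l.
Proof.
move=> /cvg_cabsP h; apply/cvgrPdist_lt => e e0; near=> t.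
rewrite -raddfB (le_lt_trans (cabs_Re _))//.
by near: t; exact: h.
Unshelve. all: end_near. Qed.

Lemma Im_cvg T (F : set_system T) (FF : Filter F) (f : T -> C) (l : C) :
  f @ F --> l -> (fun t => complex.Im (f t)) @ F --> complex.Im l.
Proof.
move=> /cvg_cabsP h; apply/cvgrPdist_lt => e e0; near=> t.
rewrite -raddfB (le_lt_trans (cabs_Im _))//.
by near: t; exact: h.
Unshelve. all: end_near. Qed.

Lemma mkc_cvg T (F : set_system T) (FF : Filter F) (a b : T -> R) (la lb : R) :
  a @ F --> la -> b @ F --> lb ->
  (fun t => (a t +i* b t)%C : C) @ F --> ((la +i* lb)%C : C).
Proof.
move=> /cvgrPdist_lt ha /cvgrPdist_lt hb; apply/cvg_cabsP => e e0; near=> t.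
rewrite (le_lt_trans (cabs_le_ReIm _))//= (splitr e) ltrD//.
- by near: t; apply: ha; rewrite divr_gt0.
- by near: t; apply: hb; rewrite divr_gt0.
Unshelve. all: end_near. Qed.

Lemma conj_cvg T (F : set_system T) (FF : Filter F) (f : T -> C) (l : C) :
  f @ F --> l -> (fun t => (f t)^* : C) @ F --> (l^* : C).
Proof.
move=> h; have E (z : R[i]) : z^* = (complex.Re z +i* - complex.Im z)%C by case: z.
rewrite E; under eq_cvg do rewrite E; apply: mkc_cvg; first exact: Re_cvg.
by apply: cvgN; exact: Im_cvg.
Qed.

End ComplexTopology.
Arguments cabs : simpl never.

(** * Integrals of complex functions of a real variable *)

Section Cint.
Variable R : realType.
Local Notation C := (R[i]^o).
Local Notation mu := (@lebesgue_measure R).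
Implicit Types (g h : R -> C) (a b c : R) (k : R[i]).

Definition cint a b g : R[i] :=
  ((\int[mu]_(x in `[a, b]) complex.Re (g x)) +i*
   (\int[mu]_(x in `[a, b]) complex.Im (g x)))%C.

Lemma Re_continuous g : continuous g -> continuous (fun x => complex.Re (g x)).
Proof. by move=> cg x; apply: Re_cvg; exact: cg. Qed.

Lemma Im_continuous g : continuous g -> continuous (fun x => complex.Im (g x)).
Proof. by move=> cg x; apply: Im_cvg; exact: cg. Qed.

Lemma continuous_integrable (f : R -> R) a b : continuous f ->
  mu.-integrable `[a, b] (EFin \o f).
Proof.
move=> cf; apply: continuous_compact_integrable; first exact: segment_compact.
by apply: continuous_subspaceT.
Qed.

Local Hint Resolve Re_continuous Im_continuous continuous_integrable : core.

Lemma eq_cint a b g h : (forall x, a <= x <= b -> g x = h x) ->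
  cint a b g = cint a b h.
Proof.
move=> gh; rewrite /cint; congr (_ +i* _)%C; apply: eq_Rintegral => x;
  by rewrite inE/= in_itv/= => /gh ->.
Qed.

Lemma cintD a b g h : continuous g -> continuous h ->
  cint a b (fun x => g x + h x) = cint a b g + cint a b h.
Proof.
move=> cg ch; apply/eqP; rewrite eq_complex/=; apply/andP; split; apply/eqP.
- by rewrite -RintegralD//; auto; apply: eq_Rintegral => x _; rewrite raddfD.
- by rewrite -RintegralD//; auto; apply: eq_Rintegral => x _; rewrite raddfD.
Qed.

Lemma cintZ a b k g : continuous g ->
  cint a b (fun x => k * g x) = k * cint a b g.
Proof.
move=> cg; rewrite /cint; case: k => u v; simpc.
have E (x y : R) : continuous (fun t => x * complex.Re (g t) + y * complex.Im (g t)).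
  move=> t; apply: cvgD; apply: cvgM; try exact: cvg_cst.
    exact: Re_continuous.
  exact: Im_continuous.
congr (_ +i* _)%C.
- rewrite -!RintegralZl//; auto; rewrite -RintegralB//=.
  + by apply: eq_Rintegral => x _; case: (g x).
  + by apply: continuous_integrable => t; apply: cvgM; [exact: cvg_cst|exact: Re_continuous].
  + by apply: continuous_integrable => t; apply: cvgM; [exact: cvg_cst|exact: Im_continuous].
- rewrite -!RintegralZl//; auto; rewrite -RintegralD//=.
  + by apply: eq_Rintegral => x _; case: (g x).
  + by apply: continuous_integrable => t; apply: cvgM; [exact: cvg_cst|exact: Im_continuous].
  + by apply: continuous_integrable => t; apply: cvgM; [exact: cvg_cst|exact: Re_continuous].
Qed.

Lemma cintN a b g : continuous g -> cint a b (fun x => - g x) = - cint a b g.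
Proof.
move=> cg; rewrite -mulN1r -cintZ//; apply: eq_cint => x _.
by rewrite mulN1r.
Qed.

Lemma cintB a b g h : continuous g -> continuous h ->
  cint a b (fun x => g x - h x) = cint a b g - cint a b h.
Proof.
move=> cg ch; have cNh : continuous (fun x => - h x).
  by move=> x; apply: cvgN; exact: ch.
by rewrite (cintD a b cg cNh) cintN.
Qed.

Lemma cint_conj a b g : continuous g ->
  cint a b (fun x => (g x)^*) = (cint a b g)^*.
Proof.
move=> cg; rewrite /cint /=; congr (_ +i* _)%C.
  by apply: eq_Rintegral => x _; case: (g x).
rewrite -[RHS]mulN1r -RintegralZl//; auto.
by apply: eq_Rintegral => x _; case: (g x) => u v /=; rewrite mulN1r.
Qed.

Lemma cint_cst a b k : a <= b -> cint a b (fun=> k) = (b - a)%:C%C * k.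
Proof.
move=> ab; rewrite /cint !Rintegral_cst//= lebesgue_measure_itv/= lte_fin.
case: k => u v/=; simpc.
case: ltP => [_|ba] /=; first by congr (_ +i* _)%C; rewrite mulrC.
have -> : b = a by apply/eqP; rewrite eq_le ab ba.
by rewrite subrr !mulr0 !mul0r.
Qed.

Lemma cint_split a b c g : continuous g -> a <= b -> b <= c ->
  cint a c g = cint a b g + cint b c g.
Proof.
move=> cg ab bc.
have E (f : R -> R) : continuous f -> \int[mu]_(x in `[a, c]) f x =
  \int[mu]_(x in `[a, b]) f x + \int[mu]_(x in `[b, c]) f x.
  move=> cf.
  rewrite -[X in _ = _ + X]Rintegral_itv_obnd_cbnd; last first.
    by apply: integrableS (continuous_integrable b c cf) => //;
    by move=> x /=; rewrite !in_itv/= => /andP[/ltW-> ->].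
  rewrite -(@Rintegral_itvB _ f (BLeft a) (BRight c) b) ?bnd_simp//; auto.
  by rewrite addrC subrK.
by rewrite /cint (E _ (Re_continuous cg)) (E _ (Im_continuous cg)); simpc.
Qed.

(** The factor 2 comes from bounding the real and imaginary parts separately; the bisection argument
    tolerates any constant. *)
Lemma cabs_cint a b g (M : R) : continuous g -> a <= b ->
  (forall x, a <= x <= b -> cabs (g x) <= M) ->
  cabs (cint a b g) <= 2 * M * (b - a).
Proof.
move=> cg ab gM; rewrite (le_trans (cabs_le_ReIm _))//=.
have E (f : R -> R) : continuous f -> (forall x, a <= x <= b -> `|f x| <= M) ->
  `|\int[mu]_(x in `[a, b]) f x| <= M * (b - a).
  move=> cf fM; rewrite (le_trans (le_normr_Rintegral _ _))//; auto.
  have -> : M * (b - a) = \int[mu]_(x in `[a, b]) M.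
    rewrite Rintegral_cst//= lebesgue_measure_itv/= lte_fin.
    case: ltP => [_|ba] //=.
    have -> : b = a by apply/eqP; rewrite eq_le ab ba.
    by rewrite subrr.
  apply: le_Rintegral => //.
  - by apply: continuous_integrable => x; apply: cvg_norm; exact: cf.
  - by apply: continuous_integrable => x; exact: cvg_cst.
have -> : 2 * M * (b - a) = M * (b - a) + M * (b - a) by ring.
apply: lerD.
- apply: E; first exact: Re_continuous.
  by move=> x xab; rewrite (le_trans (cabs_Re _))// gM.
- apply: E; first exact: Im_continuous.
  by move=> x xab; rewrite (le_trans (cabs_Im _))// gM.
Qed.

Lemma Re_cint_ge0 a b g : (forall x, 0 <= complex.Re (g x)) ->
  0 <= complex.Re (cint a b g).
Proof. by move=> h; rewrite /cint /= Rintegral_ge0. Qed.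

End Cint.
Arguments cint : simpl never.

(** * Goursat's theorem on rectangles *)

Section Goursat.
Variable R : realType.
Local Notation C := (R[i]^o).
Variable G : R -> R -> C.
Hypothesis contl : forall y, continuous (fun x => G x y).
Hypothesis contr : forall x, continuous (G x).
Implicit Types (a b c d : R).

(** The counterclockwise contour integral of G dz around the rectangle: bottom minus top side, plus
    i times right minus left side. *)
Definition rect_int a b c d : R[i] :=
  cint a b (fun x => G x c - G x d) + 'i%C * cint c d (fun y => G b y - G a y).

Lemma continuousB1 (f g : R -> C) : continuous f -> continuous g ->
  continuous (fun x => f x - g x).
Proof. by move=> cf cg x; apply: cvgB; [exact: cf|exact: cg]. Qed.

Lemma rect_int_splitl a m b c d : a <= m -> m <= b ->
  rect_int a b c d = rect_int a m c d + rect_int m b c d.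
Proof.
move=> am mb; rewrite /rect_int (@cint_split _ a m b)//; last exact: continuousB1.
have /= -> : cint c d (fun y => G b y - G a y) =
  cint c d (fun y => G b y - G m y) + cint c d (fun y => G m y - G a y).
  rewrite -cintD; try exact: continuousB1.
  by apply: eq_cint => y _; rewrite addrA subrK.
by ring.
Qed.

Lemma rect_int_splitr a b c m d : c <= m -> m <= d ->
  rect_int a b c d = rect_int a b c m + rect_int a b m d.
Proof.
move=> cm md; rewrite /rect_int (@cint_split _ c m d)//; last exact: continuousB1.
have /= -> : cint a b (fun x => G x c - G x d) =
  cint a b (fun x => G x c - G x m) + cint a b (fun x => G x m - G x d).
  rewrite -cintD; try exact: continuousB1.
  by apply: eq_cint => y _; rewrite addrA subrK.
by ring.
Qed.

Lemma cint_near_cst a b (g : R -> C) (k : R[i]) (M : R) :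
  continuous g -> a <= b -> (forall x, a <= x <= b -> cabs (g x - k) <= M) ->
  cabs (cint a b g - (b - a)%:C%C * k) <= 2 * M * (b - a).
Proof.
move=> cg ab gM; have ck : continuous (fun _ : R => k : C) by exact: cst_continuous.
rewrite -(cint_cst k ab) -(cintB a b cg ck).
exact: cabs_cint (continuousB1 cg ck) ab gM.
Qed.

(** Complex differentiability relative to [Q], so that one-sided information suffices at the
    boundary of the rectangle. *)
Definition cdiff_at (Q : R -> R -> Prop) (x0 y0 : R) :=
  exists k : R[i], forall e : R, 0 < e -> exists2 del : R, 0 < del &
    forall x y, Q x y -> `|x - x0| < del -> `|y - y0| < del ->
      cabs (G x y - G x0 y0 - k * ((x - x0) +i* (y - y0))%C)
        <= e * (`|x - x0| + `|y - y0|).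

(** The affine part of G integrates to 0 around the rectangle. With w and h the side lengths, the
    remainder is at most e (w + h) on the boundary; differences of opposite sides double this and
    [cabs_cint] doubles it again, giving 4 e (w + h) times w + h. *)
Lemma rect_int_near (Q : R -> R -> Prop) x0 y0 : cdiff_at Q x0 y0 ->
  forall e, 0 < e -> exists2 del : R, 0 < del & forall a b c d,
    a <= x0 <= b -> c <= y0 <= d -> b - a < del -> d - c < del ->
    (forall x y, a <= x <= b -> c <= y <= d -> Q x y) ->
    cabs (rect_int a b c d) <= 4 * e * (b - a + (d - c)) ^+ 2.
Proof.
move=> [k hk] e e0; have [del del0 hdel] := hk e e0.
exists del => // a b c d abx cdy wdel hdel' Qabcd.
have [ab cd] : a <= b /\ c <= d.
  by split; [case/andP: abx; exact: le_trans|case/andP: cdy; exact: le_trans].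
pose E x y : R[i] := G x y - G x0 y0 - k * ((x - x0) +i* (y - y0))%C.
have EM x y : a <= x <= b -> c <= y <= d ->
    cabs (E x y) <= e * (b - a + (d - c)).
  move=> xab ycd.
  have xw : `|x - x0| <= b - a by rewrite ler_norml; lra.
  have yh : `|y - y0| <= d - c by rewrite ler_norml; lra.
  rewrite (le_trans (hdel x y _ _ _))//; first exact: Qabcd.
  - exact: le_lt_trans xw _.
  - exact: le_lt_trans yh _.
  - exact: ler_wpM2l (ltW e0) _ _ (lerD xw yh).
(* [k1] and [k2] are the differences of the linear part between opposite sides; their contributions
   (b - a) k1 and i (d - c) k2 cancel. *)
pose k1 : R[i] := k * (0 +i* (c - d))%C.
pose k2 : R[i] := k * (b - a)%:C%C.
have H1 : cabs (cint a b (fun x => G x c - G x d) - (b - a)%:C%C * k1)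
    <= 2 * (2 * (e * (b - a + (d - c)))) * (b - a).
  apply: cint_near_cst => //; first exact: continuousB1.
  move=> x xab; have -> : G x c - G x d - k1 = E x c - E x d.
    rewrite /E /k1 /=.
    have -> : ((0 +i* (c - d)) = ((x - x0) +i* (c - y0)) - ((x - x0) +i* (d - y0)) :> R[i])%C.
      by simpc; congr (_ +i* _)%C; ring.
    by ring.
  rewrite (le_trans (cabsD _ _))// cabsN mulr_natl mulr2n lerD// EM// ?lexx ?cd//.
have H2 : cabs (cint c d (fun y => G b y - G a y) - (d - c)%:C%C * k2)
    <= 2 * (2 * (e * (b - a + (d - c)))) * (d - c).
  apply: cint_near_cst => //; first exact: continuousB1.
  move=> y ycd; have -> : G b y - G a y - k2 = E b y - E a y.
    rewrite /E /k2 /=.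
    have -> : ((b - a)%:C = ((b - x0) +i* (y - y0)) - ((a - x0) +i* (y - y0)) :> R[i])%C.
      by simpc; congr (_ +i* _)%C; ring.
    by ring.
  rewrite (le_trans (cabsD _ _))// cabsN mulr_natl mulr2n lerD// EM// ?lexx ?ab//.
have -> : rect_int a b c d =
   (cint a b (fun x => G x c - G x d) - (b - a)%:C%C * k1) +
   'i%C * (cint c d (fun y => G b y - G a y) - (d - c)%:C%C * k2).
  rewrite /rect_int mulrBr addrACA -opprD -[LHS]subr0; congr (_ - _).
  rewrite /k1 /k2.
  have -> : (0 +i* (c - d))%C = 'i%C * (c - d)%:C%C :> R[i] by simpc.
  by rewrite (_ : (c - d)%:C%C = - (d - c)%:C%C); [ring|rewrite -raddfN opprB].
rewrite (le_trans (cabsD _ _))// cabsM cabs_i mul1r (le_trans (lerD H1 H2))//.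
by rewrite le_eqVlt; apply/orP; left; apply/eqP; ring.
Qed.

End Goursat.
Arguments rect_int : simpl never.

Lemma nested_intervals (R : realType) (a w : nat -> R) :
  (forall n, a n <= a n.+1) -> (forall n, a n.+1 + w n.+1 <= a n + w n) ->
  (forall n, 0 <= w n) -> exists p, forall n, a n <= p <= a n + w n.
Proof.
move=> a_nd b_ni w0.
have /nondecreasing_seqP am := a_nd.
have /nonincreasing_seqP bm :
  forall n, (fun n => a n + w n) n.+1 <= (fun n => a n + w n) n by [].
have ab m n : a m <= a n + w n.
  have := am _ _ (leq_maxl m n).
  have /= := bm _ _ (leq_maxr m n).
  by move=> h1 h2; have := w0 (maxn m n); lra.
have ubA n : ubound (range a) (a n + w n) by move=> _ [m _ <-].
have supA : has_sup (range a) by split; [exists (a 0%N), 0%N|exists (a 0%N + w 0%N)].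
exists (sup (range a)) => n; apply/andP; split.
- by apply: ub_le_sup; [exact: (proj2 supA)|exists n].
- by apply: ge_sup => //; [exact: (proj1 supA)].
Qed.

(** If the integral were nonzero, one quarter of each rectangle would inherit at least a quarter of
    it, so the integral would shrink like 4^-n. Differentiability at the common point of the nested
    rectangles makes it o(4^-n). *)
Lemma goursat (R : realType) (G : R -> R -> R[i]^o) (a b c d : R) :
  (forall y, continuous (fun x => G x y)) -> (forall x, continuous (G x)) ->
  a <= b -> c <= d ->
  (forall x0 y0, a <= x0 <= b -> c <= y0 <= d ->
    cdiff_at G (fun x y => a <= x <= b /\ c <= y <= d) x0 y0) ->
  rect_int G a b c d = 0.
Proof.
move=> contl contr ab cd Gdiff; apply/eqP; apply/negPn/negP => neq0.
have I0 : 0 < cabs (rect_int G a b c d).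
  by rewrite -ltcR -cabsE normr_gt0.
(* Halving makes the strict inequality in [big] true at generation 0. *)
pose eta := cabs (rect_int G a b c d) / 2.
have eta0 : 0 < eta by rewrite divr_gt0.
pose w n : R := (b - a) * 2^-1 ^+ n; pose h n : R := (d - c) * 2^-1 ^+ n.
have wS n : w n = w n.+1 + w n.+1 by rewrite /w exprS; field.
have hS n : h n = h n.+1 + h n.+1 by rewrite /h exprS; field.
have w0 n : 0 <= w n by rewrite mulr_ge0 ?subr_ge0// exprn_ge0.
have h0 n : 0 <= h n by rewrite mulr_ge0 ?subr_ge0// exprn_ge0.
(* The dyadic subrectangle of generation [n] with corner [p] carries more than
   its share of the integral. *)
pose big n (p : R * R) :=
  eta * 4^-1 ^+ n < cabs (rect_int G p.1 (p.1 + w n) p.2 (p.2 + h n)).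
pose child n (p q : R * R) := (q.1 = p.1 \/ q.1 = p.1 + w n.+1) /\
  (q.2 = p.2 \/ q.2 = p.2 + h n.+1).
have step n p : exists q, big n p -> child n p q /\ big n.+1 q.
  have [bp|nbp] := pselect (big n p); last by exists p.
  case: p bp => x y bp.
  suff [q [cq bq]] : exists q, child n (x, y) q /\ big n.+1 q by exists q.
  apply: contrapT => nq.
  have sm q : child n (x, y) q ->
      cabs (rect_int G q.1 (q.1 + w n.+1) q.2 (q.2 + h n.+1)) <= eta * 4^-1 ^+ n.+1.
    by move=> cq; rewrite leNgt; apply/negP => bq; apply: nq; exists q.
  move: bp; apply/negP; rewrite -leNgt /=.
  have x1 : x <= x + w n.+1 by rewrite lerDl.
  have x2 : x + w n.+1 <= x + w n by rewrite lerD2l (wS n) lerDl.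
  have y1 : y <= y + h n.+1 by rewrite lerDl.
  have y2 : y + h n.+1 <= y + h n by rewrite lerD2l (hS n) lerDl.
  rewrite (rect_int_splitl contl contr _ _ x1 x2).
  rewrite !(rect_int_splitr contl contr _ _ y1 y2).
  have -> : x + w n = x + w n.+1 + w n.+1 by rewrite (wS n) addrA.
  have -> : y + h n = y + h n.+1 + h n.+1 by rewrite (hS n) addrA.
  have e4 : eta * 4^-1 ^+ n = eta * 4^-1 ^+ n.+1 + eta * 4^-1 ^+ n.+1 +
    (eta * 4^-1 ^+ n.+1 + eta * 4^-1 ^+ n.+1) by rewrite exprS; field.
  rewrite e4.
  rewrite (le_trans (cabsD _ _))// lerD// (le_trans (cabsD _ _))// lerD//.
  - by apply: (sm (x, y)); split; left.
  - by apply: (sm (x, y + h n.+1)); split; [left|right].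
  - by apply: (sm (x + w n.+1, y)); split; [right|left].
  - by apply: (sm (x + w n.+1, y + h n.+1)); split; right.
have /choice[f fP] : forall np : nat * (R * R), exists q,
  big np.1 np.2 -> child np.1 np.2 q /\ big np.1.+1 q by case=> n p; exact: step.
pose P := fix P n := if n is m.+1 then f (m, P m) else (a, c).
have bigP n : big n (P n).
  elim: n => [|n IH].
    rewrite /big /w /h /= !expr0 !mulr1 [a + _]addrC [c + _]addrC !subrK /eta.
    by rewrite ltr_pdivrMr// ltr_pMr// ltr1n.
  exact: (proj2 (fP (n, P n) IH)).
have childP n : child n (P n) (P n.+1) by exact: (proj1 (fP (n, P n) (bigP n))).
have [||x0 x0P] := @nested_intervals R (fun n => (P n).1) w _ _ w0.
- move=> n; have := w0 n.+1; case: (childP n) => -[->|->] _; lra.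
- move=> n; have := w0 n.+1; have := wS n; case: (childP n) => -[->|->] _; lra.
have [||y0 y0P] := @nested_intervals R (fun n => (P n).2) h _ _ h0.
- move=> n; have := h0 n.+1; case: (childP n) => _ [->|->]; lra.
- move=> n; have := h0 n.+1; have := hS n; case: (childP n) => _ [->|->]; lra.
have sub n : [/\ a <= (P n).1, (P n).1 + w n <= b, c <= (P n).2 & (P n).2 + h n <= d].
  elim: n => [|n [aP Pb cP Pd]].
    by rewrite /w /h /= !expr0 !mulr1; split; lra.
  have := w0 n.+1; have := wS n; have := h0 n.+1; have := hS n.
  by case: (childP n) => -[->|->] [->|->] *; split; lra.
have [x0ab y0cd] : a <= x0 <= b /\ c <= y0 <= d.
  have := x0P 0%N; have := y0P 0%N; rewrite /w /h /= !expr0 !mulr1.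
  by move=> *; split; lra.
(* The summand 1 keeps [L] positive for degenerate rectangles. With [e] as below, 4 e (w n + h n)^2
   is at most eta 4^-n, which contradicts [bigP n]. *)
pose L := b - a + (d - c) + 1.
have L1 : 1 <= L by rewrite /L; lra.
pose e := eta / (4 * L ^+ 2).
have e0 : 0 < e by rewrite divr_gt0// mulr_gt0// exprn_gt0// (lt_le_trans _ L1).
have [del del0 hdel] := rect_int_near contl contr (Gdiff x0 y0 x0ab y0cd) e0.
have [n wn hn] : exists2 n, w n < del & h n < del.
  have geo : (fun n => L * 2^-1 ^+ n) @ \oo --> L * 0.
    by apply: cvgMr; apply: cvg_expr; rewrite ger0_norm ?invf_lt1// ltr1n.
  rewrite mulr0 in geo.
  have /cvgrPdist_lt/(_ _ del0)[N _ /(_ N (leqnn _))] := geo.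
  rewrite /= sub0r normrN ger0_norm ?mulr_ge0 ?exprn_ge0// ?(le_trans _ L1)// => LN.
  exists N; apply: le_lt_trans LN; rewrite /w /h ler_wpM2r ?exprn_ge0// /L; lra.
have [aP Pb cP Pd] := sub n.
have := bigP n; apply/negP; rewrite -leNgt.
apply: le_trans (hdel _ _ _ _ (x0P n) (y0P n) _ _ _) _.
- by rewrite addrAC subrr add0r.
- by rewrite addrAC subrr add0r.
- by move=> x y /andP[? ?] /andP[? ?]; split; lra.
rewrite !(addrAC _ _ (- _)) !subrr !add0r /w /h -mulrDl exprMn -exprM mulnC exprM.
rewrite (_ : 2^-1 ^+ 2 = 4^-1 :> R); last by field.
rewrite !mulrA ler_wpM2r ?exprn_ge0// /e.
rewrite /eta [leLHS](_ : _ = cabs (rect_int G a b c d) / 2 *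
  ((b - a + (d - c)) / L) ^+ 2); last first.
  by field; rewrite gt_eqF// (lt_le_trans _ L1).
rewrite -/eta ler_piMr ?(ltW eta0)// expr_le1//.
- by rewrite ler_pdivrMr ?(lt_le_trans _ L1)// mul1r /L; lra.
- by rewrite divr_ge0 ?(le_trans _ L1)//; lra.
Qed.

(** * The mean value property *)

Section DeriveEps.
Context {K : numFieldType}.

Lemma derive_eps (f : K^o -> K^o) (x d : K) : is_derive (x : K^o) 1 f d ->
  forall e : K, 0 < e -> exists2 del : K, 0 < del &
    forall h : K, `|h| < del -> `|f (x + h) - f x - d * h| <= e * `|h|.
Proof.
move=> [fx fd] e e0.
have : (fun h : K^o => h^-1 *: (f (h *: (1 : K^o) + x) - f x)) @ 0^' --> (d : K^o).
  by rewrite -fd; exact: fx.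
move=> /cvgrPdist_le /(_ _ e0) [del /= del0 H].
exists del => // h hdel; have [->|h0] := eqVneq h 0.
  by rewrite addr0 subrr mulr0 subr0 normr0 mulr0 lexx.
have := H h; rewrite /ball_/= sub0r normrN => /(_ hdel h0) hh.
have -> : f (x + h) - f x - d * h = - (d - h^-1 *: (f (h *: (1 : K^o) + x) - f x)) * h.
  have -> : h *: (1 : K^o) = h by rewrite /GRing.scale/= mulr1.
  rewrite opprB mulrBl; congr (_ - _).
  by rewrite [x + h]addrC /GRing.scale/= mulrAC mulVf// mul1r.
by rewrite normrM normrN ler_wpM2r.
Qed.
End DeriveEps.

Section Polar.
Variable R : realType.
Local Notation C := (R[i]^o).

Definition cis (t : R) : R[i] := (cos t +i* sin t)%C.

Lemma cabs_cis t : cabs (cis t) = 1.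
Proof. by rewrite /cabs /= cos2Dsin2 sqrtr1. Qed.

Lemma cisD s t : cis (s + t) = cis s * cis t.
Proof. by rewrite /cis cosD sinD; simpc; congr (_ +i* _)%C; ring. Qed.

Lemma cis_continuous : continuous (cis : R -> C).
Proof. by move=> t; apply: mkc_cvg; [exact: continuous_cos|exact: continuous_sin]. Qed.

Lemma cis_2pi t : cis (t + pi *+ 2) = cis t.
Proof. by rewrite /cis cosD2pi sinD2pi. Qed.

(** First-order expansion of exp(u + i v) at 0, the inner half of the chain rule for p(exp(s + i
    t)). *)
Lemma cis_expR_expansion (e : R) : 0 < e -> exists2 del : R, 0 < del &
  forall u v, `|u| < del -> `|v| < del ->
    cabs ((expR u)%:C%C * cis v - 1 - (u +i* v)%C) <= e * (`|u| + `|v|).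
Proof.
(* The four error terms [n1] to [n4] below add up to at most e' |u| + 7 e' |v|, whence the division
   by 8. *)
move=> e0; pose e' := Num.min 1 (e / 8).
have e'0 : 0 < e' by rewrite lt_min ltr01 divr_gt0.
have e'1 : e' <= 1 by rewrite ge_min lexx.
have e'e : 8 * e' <= e.
  have : e' <= e / 8 by rewrite ge_min lexx orbT.
  lra.
clearbody e'.
have [d1 d10 H1] := derive_eps (is_derive_expR 0) e'0.
have [d2 d20 H2] := derive_eps (is_derive_cos 0) e'0.
have [d3 d30 H3] := derive_eps (is_derive_sin 0) e'0.
exists (Num.min (Num.min d1 d2) (Num.min d3 e')).
  by rewrite !lt_min d10 d20 d30 e'0.
move=> u v; rewrite !lt_min => /andP[/andP[u1 _] /andP[_ ue]].
move=> /andP[/andP[_ v2] /andP[v3 _]].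
have := H1 u u1; have := H2 v v2; have := H3 v v3.
rewrite !add0r expR0 sin0 cos0 oppr0 mul0r !mul1r !subr0 addr0.
set A := expR u - 1 - u; set B := cos v - 1; set D := sin v - v => hD hB hA.
have hA1 : `|A| <= e' by rewrite (le_trans hA)// ler_piMr// ltW// (lt_le_trans ue).
have u1' : `|u| <= 1 by rewrite ltW// (lt_le_trans ue).
have -> : (expR u)%:C%C * cis v - 1 - (u +i* v)%C =
    ((A * cos v + (1 + u) * B) +i* ((A + 1 + u) * D + (A + u) * v))%C.
  apply/eqP; rewrite eq_complex /A /B /D /=.
  by apply/andP; split; apply/eqP; ring.
rewrite (le_trans (cabs_le_ReIm _))//=.
have n1 : `|A * cos v| <= `|A|.
  by rewrite normrM ler_piMr// cos_max.
have n2 : `|(1 + u) * B| <= 2 * `|B|.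
  rewrite normrM ler_wpM2r// (le_trans (ler_normD _ _))// normr1; lra.
have n3 : `|(A + 1 + u) * D| <= 3 * `|D|.
  rewrite normrM ler_wpM2r// (le_trans (ler_normD _ _))//.
  by have := ler_normD A 1; rewrite normr1; lra.
have n4 : `|(A + u) * v| <= (2 * e') * `|v|.
  rewrite normrM ler_wpM2r// (le_trans (ler_normD _ _))//; lra.
have n5 := ler_normD (A * cos v) ((1 + u) * B).
have n6 := ler_normD ((A + 1 + u) * D) ((A + u) * v).
have n7 : 8 * (e' * `|u|) <= e * `|u| by rewrite mulrA ler_wpM2r.
have n8 : 8 * (e' * `|v|) <= e * `|v| by rewrite mulrA ler_wpM2r.
have n9 : 0 <= e' * `|u| by rewrite mulr_ge0// ltW.
have n10 : 0 <= e' * `|v| by rewrite mulr_ge0// ltW.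
rewrite [leRHS]mulrDr; rewrite -mulrA in n4.
lra.
Qed.

Lemma real_cvg (f : R -> R) (t : R) : {for t, continuous f} ->
  {for t, continuous ((fun x => (f x)%:C%C) : R -> C)}.
Proof. by move=> ft; apply: mkc_cvg => //; exact: cvg_cst. Qed.

End Polar.

Section MeanValue.
Variable R : realType.
Local Notation C := (R[i]^o).

Section CircleMeans.
Variable p : C -> C.
Hypothesis p_cont : forall z : R[i], cabs z <= 1 -> {for z, continuous p}.

(* Clamping the radius makes the integrand globally continuous although [p] is
   only controlled on the closed disk. *)
Let clamp (r : R) : R := Num.max 0 (Num.min r 1).

Let clamp_continuous : continuous clamp.
Proof.
move=> r; rewrite /clamp.
apply: (@continuous_max R R (fun=> 0) (fun r => Num.min r 1)).
  exact: cvg_cst.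
by apply: (@continuous_min R R id (fun=> 1)); [exact: cvg_id|exact: cvg_cst].
Qed.

Let clamp01 r : 0 <= clamp r <= 1.
Proof. by rewrite /clamp le_max lexx ge_max ler01 ge_min lexx orbT. Qed.

Let clampE r : 0 <= r <= 1 -> clamp r = r.
Proof. by move=> /andP[r0 r1]; rewrite /clamp (min_idPl r1) (max_idPr r0). Qed.

Lemma polar_disk (r t : R) : 0 <= r <= 1 -> cabs (r%:C%C * cis t) <= 1.
Proof. by move=> /andP[r0 r1]; rewrite cabsM cabs_cis mulr1 cabs_real ger0_norm. Qed.

Let F (r t : R) : C := p ((clamp r)%:C%C * cis t).

Let F_cont : continuous (fun rt : R * R => F rt.1 rt.2).
Proof.
move=> [r t]; rewrite /F /=.
apply: (@continuous_comp (R * R)%type C C (fun rt => (clamp rt.1)%:C%C * cis rt.2) p).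
  apply: cvgM.
  - apply: (@cvg_comp _ _ _ (fun rt : R * R => clamp rt.1)
      (fun x => x%:C%C : C) _ (nbhs (clamp r))).
      by apply: (@cvg_comp _ _ _ (@fst R R) clamp _ (nbhs r));
        [exact: cvg_fst|exact: clamp_continuous].
    by apply: (@real_cvg _ id); exact: cvg_id.
  - by apply: (@cvg_comp _ _ _ (@snd R R) (@cis R : R -> C) _ (nbhs t));
      [exact: cvg_snd|exact: cis_continuous].
by apply: p_cont; exact: polar_disk.
Qed.

(** The dominating constant for continuity under the integral sign; clamping makes it uniform over
    all real radii. *)
Let F_bounded : exists B : R, forall r t, 0 <= t <= pi *+ 2 -> cabs (F r t) <= B.
Proof.
have cptQ : compact (`[0, 1]%classic `*` `[0, pi *+ 2]%classic : set (R * R)).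
  exact: (compact_setX (@segment_compact R 0 1) (@segment_compact R 0 (pi *+ 2))).
have Q0 : (`[0, 1]%classic `*` `[0, pi *+ 2]%classic : set (R * R)) !=set0.
  by exists (0, 0); split; rewrite /= in_itv/= lexx ?ler01// mulrn_wge0// pi_ge0.
pose N := fun rt : R * R => `|complex.Re (F rt.1 rt.2)| + `|complex.Im (F rt.1 rt.2)|.
have cN : continuous N.
  move=> rt; apply: cvgD; apply: cvg_norm; [apply: Re_cvg|apply: Im_cvg]; exact: F_cont.
have [c _ cmax] := @compact_EVT_max _ R N _ Q0 cptQ (continuous_subspaceT cN).
exists (N c) => r t t2; rewrite (le_trans (cabs_le_ReIm _))//.
have := cmax (clamp r, t); rewrite /N /F /= (clampE (clamp01 r)); apply.
by rewrite inE; split; rewrite /= in_itv/=.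
Qed.

Let F_cont2 r : continuous (F r).
Proof.
move=> t; apply: (@continuous_comp R (R * R)%type C
  (fun t => (r, t)) (fun rt : R * R => F rt.1 rt.2)); last exact: F_cont.
by apply: (@cvg_pair _ _ _ (nbhs t) (nbhs r) (nbhs t)); [exact: cvg_cst|exact: cvg_id].
Qed.

Let F_cont1 t : continuous (F ^~ t).
Proof.
move=> r; apply: (@continuous_comp R (R * R)%type C
  (fun r => (r, t)) (fun rt : R * R => F rt.1 rt.2)); last exact: F_cont.
by apply: (@cvg_pair _ _ _ (nbhs r) (nbhs r) (nbhs t)); [exact: cvg_id|exact: cvg_cst].
Qed.

Definition circle_int (r : R) : R[i] :=
  cint 0 (pi *+ 2) (fun t => p (r%:C%C * cis t)).

Let M r := cint 0 (pi *+ 2) (F r).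

Let ME r : 0 <= r <= 1 -> M r = circle_int r.
Proof. by move=> r01; apply: eq_cint => t _; rewrite /F clampE. Qed.

Let M_cont : continuous (M : R -> C).
Proof.
have [B hB] := F_bounded.
have H (f : R -> R -> R) : (forall t, continuous (f ^~ t)) -> (forall r, continuous (f r)) ->
   (forall r t, 0 <= t <= pi *+ 2 -> `|f r t| <= B) ->
   continuous (fun r => \int[lebesgue_measure]_(t in `[0, pi *+ 2]) f r t).
  move=> f1 f2 fB r.
  have r_in : r \in `](r - 1), (r + 1)[%classic.
    by rewrite inE /= in_itv/=; lra.
  have := @continuity_under_integral R _ _ (@lebesgue_measure R)
    f `[0, pi *+ 2]%classic _ (r - 1) (r + 1) _ _ (fun=> B) _ _ r r_in.
  apply => //.
  - by move=> x _; exact: continuous_integrable.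
  - by apply: aeW => y _ x _; exact: f1.
  - by apply: continuous_integrable => y; exact: cvg_cst.
  - by move=> x _; apply: aeW => y; rewrite /= in_itv/=; exact: fB.
move=> r; apply: mkc_cvg; apply: H => [t|x|x t t2].
- by move=> x; apply: Re_cvg; exact: F_cont1.
- exact/Re_continuous/F_cont2.
- by rewrite (le_trans (cabs_Re _))// hB.
- by move=> x; apply: Im_cvg; exact: F_cont1.
- exact/Im_continuous/F_cont2.
- by rewrite (le_trans (cabs_Im _))// hB.
Qed.

(* In the coordinate [s + i t], with [z = exp (s + i t)], the annulus is a
   rectangle whose horizontal sides cancel by periodicity. *)
Let annulus (r1 r2 : R) : 0 < r1 -> r1 <= r2 -> r2 <= 1 ->
  (forall z : R[i], r1 <= cabs z <= r2 -> derivable p z 1) -> M r1 = M r2.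
Proof.
move=> r10 r12 r21 dp; have r20 : 0 < r2 by exact: lt_le_trans r12.
pose G (s t : R) : C := F (expR s) t.
have lnr : ln r1 <= ln r2 by rewrite ler_ln ?posrE.
have pi0 : 0 <= (pi : R) *+ 2 by rewrite mulrn_wge0// pi_ge0.
have G1 y : continuous (fun x => G x y).
  move=> x; apply: (@continuous_comp R R C expR (F ^~ y)); first exact: continuous_expR.
  exact: F_cont1.
have G2 x : continuous (G x) by exact: F_cont2.
have G3 s0 t0 : ln r1 <= s0 <= ln r2 -> 0 <= t0 <= pi *+ 2 ->
    cdiff_at G (fun x y => ln r1 <= x <= ln r2 /\ 0 <= y <= pi *+ 2) s0 t0.
  move=> s0r t0r.
  pose z0 := (expR s0)%:C%C * cis t0 : R[i].
  have cz0 : cabs z0 = expR s0 by rewrite cabsM cabs_cis mulr1 cabs_real gtr0_norm ?expR_gt0.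
  have expQ s : ln r1 <= s <= ln r2 -> r1 <= expR s <= r2.
    by rewrite -{2}(@lnK _ r1) ?posrE// -{2}(@lnK _ r2) ?posrE// !ler_expR.
  have clQ s : ln r1 <= s <= ln r2 -> clamp (expR s) = expR s.
    by move=> /expQ /andP[h1 h2]; rewrite clampE// expR_ge0 (le_trans h2).
  have dz0 : derivable p z0 1 by apply: dp; rewrite cz0 expQ.
  pose D : R[i] := 'D_1 p z0.
  (* Chain rule: the derivative of p(exp(s + i t)) with respect to s + i t is p'(z0) z0. *)
  exists (D * z0) => e e0.
  (* The remainder of p costs 2 e1 (|u| + |v|), since |z0 E| is at most 2 (|u| + |v|); the remainder
     of the exponential, multiplied by D z0, costs |D| e1 (|u| + |v|). *)
  pose e1 := Num.min 1 (e / (2 + cabs D)).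
  have D0 : 0 < 2 + cabs D by rewrite ltr_wpDr ?cabs_ge0.
  have e10 : 0 < e1 by rewrite lt_min ltr01 divr_gt0.
  have e11 : e1 <= 1 by rewrite ge_min lexx.
  have e1e : (2 + cabs D) * e1 <= e.
    by rewrite mulrC -ler_pdivlMr// ge_min lexx orbT.
  clearbody e1.
  have e1C : 0 < e1%:C%C :> R[i] by rewrite ltcR.
  have [del' /complex_gt0P[d1 d10 ->] H1] := derive_eps (derivableP dz0) e1C.
  have [d2 d20 H2] := cis_expR_expansion e10.
  (* Then |z0 E| <= 2 (|u| + |v|) < d1, as the expansion of p requires. *)
  exists (Num.min d2 (d1 / 4)); first by rewrite lt_min d20 divr_gt0.
  move=> x y [xQ yQ]; rewrite !lt_min => /andP[x1 x2] /andP[y1 y2].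
  set u := x - s0; set v := y - t0.
  pose E : R[i] := (expR u)%:C%C * cis v - 1.
  have zE : (expR x)%:C%C * cis y = z0 + z0 * E.
    rewrite /E mulrBr mulr1 addrC subrK /z0 mulrACA -cisD -rmorphM -expRD /u /v.
    by rewrite [s0 + _]addrC subrK [t0 + _]addrC subrK.
  have hE := H2 u v x1 y1; rewrite -/E in hE.
  have uv : cabs (u +i* v)%C <= `|u| + `|v| by exact: cabs_le_ReIm.
  have E2 : cabs E <= 2 * (`|u| + `|v|).
    have -> : E = (E - (u +i* v)%C) + (u +i* v)%C by rewrite subrK.
    rewrite (le_trans (cabsD _ _))// mulr_natl mulr2n lerD// (le_trans hE)//.
    by rewrite ler_piMl ?addr_ge0.
  have z01 : cabs z0 <= 1.
    by rewrite cz0; have /andP[_ h] := expQ _ s0r; rewrite (le_trans h).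
  have zE2 : cabs (z0 * E) <= cabs E by rewrite cabsM ler_piMl ?cabs_ge0.
  have zEd : cabs (z0 * E) < d1 by rewrite (le_lt_trans zE2)// (le_lt_trans E2)//; lra.
  have := H1 (z0 * E); rewrite ltc_norm => /(_ zEd).
  rewrite (cabsE (z0 * E)) -rmorphM lec_norm => h1.
  rewrite /G /F (clQ _ xQ) (clQ _ s0r) -/z0 zE.
  have -> : p (z0 + z0 * E) - p z0 - D * z0 * (u +i* v)%C =
    (p (z0 + z0 * E) - p z0 - D * (z0 * E)) + D * z0 * (E - (u +i* v)%C) :> R[i] by ring.
  rewrite (le_trans (cabsD _ _))//.
  have h2 : cabs (D * z0 * (E - (u +i* v)%C)) <= cabs D * (e1 * (`|u| + `|v|)).
    rewrite cabsM [cabs (D * z0)]cabsM -mulrA ler_wpM2l ?cabs_ge0//.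
    by rewrite (le_trans _ hE)// ler_piMl ?cabs_ge0.
  rewrite (le_trans (lerD h1 h2))// (@le_trans _ _ (((2 + cabs D) * e1) * (`|u| + `|v|)))//.
    have h3 := ler_wpM2l (ltW e10) (le_trans zE2 E2).
    by move: h3; lra.
  by rewrite ler_wpM2r ?addr_ge0.
have := goursat G1 G2 lnr pi0 G3.
rewrite /rect_int.
have -> : cint (ln r1) (ln r2) (fun x => G x 0 - G x (pi *+ 2)) = 0.
  rewrite -[RHS](mulr0 ((ln r2 - ln r1)%:C%C)) -cint_cst//; apply: eq_cint => x _.
  by rewrite /G /F -(cis_2pi 0) add0r subrr.
rewrite add0r (cintB _ _ (G2 (ln r2)) (G2 (ln r1))).
rewrite /G !lnK ?posrE// -/(M r1) -/(M r2) => /eqP.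
rewrite mulf_eq0 => /orP[/eqP i0|]; last by rewrite subr_eq0 => /eqP.
have := @cabs_i R; rewrite i0 /cabs/= expr0n/= addr0 sqrtr0 => /eqP.
by rewrite eq_sym oner_eq0.
Qed.

(** Both endpoint values are one-sided limits of the constant taken inside, which is read off at the
    midpoint. *)
Let M_const_oo (a b : R) : a < b -> (forall x y, a < x -> x <= y -> y < b -> M x = M y) ->
  M a = M b.
Proof.
move=> ab Mab.
have lim (c : R) (FF : set_system R) : ProperFilter FF -> FF `=>` nbhs c ->
    (forall x y, a < x < b -> a < y < b -> M x = M y) -> 
    (\forall x \near FF, a < x < b) -> M c = M ((a + b) / 2).
  move=> PF Fc Mxy Fab; apply/eqP; apply/negPn/negP; rewrite -subr_eq0 -normr_gt0 cabsE ltcR.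
  move=> e0; have /cvg_cabsP/(_ _ e0)/Fc H := @M_cont c.
  have [x [/= x1 x2]] := filter_ex (filterI H Fab).
  have xm : M x = M ((a + b) / 2) by apply: Mxy => //; lra.
  by move: x1; rewrite /= xm ltxx.
have Mxy x y : a < x < b -> a < y < b -> M x = M y.
  move=> /andP[ax xb] /andP[ay yb]; case: (leP x y) => [|/ltW] xy; first exact: Mab.
  by symmetry; exact: Mab.
rewrite (lim a (a^'+)%classic)//; last 2 first.
  exact: cvg_within.
  by near=> x; apply/andP; split.
rewrite (lim b (b^'-)%classic)//; last 2 first.
  exact: cvg_within.
  by near=> x; apply/andP; split.
Unshelve. all: end_near. Qed.

Lemma circle_int0 : circle_int 0 = (pi *+ 2)%:C%C * p 0.
Proof.
have := @cint_cst R 0 (pi *+ 2) (p 0) (mulrn_wge0 _ (pi_ge0 R)).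
rewrite subr0 => <-.
by apply: eq_cint => t _; rewrite mul0r.
Qed.

(* On the circle of radius [rho] only continuity is required: the means are
   constant on either side of it and continuous across it. This absorbs the
   removable singularity of difference quotients at a point of modulus
   [rho]. *)
Lemma circle_int_mean (rho : R) : 0 <= rho < 1 ->
  (forall z, cabs z <= 1 -> z != 0 -> cabs z != rho -> derivable p z 1) ->
  circle_int 1 = (pi *+ 2)%:C%C * p 0.
Proof.
move=> /andP[rho0 rho1] dp; rewrite -circle_int0 -!ME ?lexx ?ler01//.
have cn0 (z : R[i]) (r : R) : 0 < r -> r <= cabs z -> z != 0.
  move=> r0 rz; apply/eqP => z0; move: rz; rewrite z0 /cabs /= expr0n/= addr0 sqrtr0.
  by rewrite leNgt r0.
have <- : M rho = M 1.
  apply: M_const_oo => // x y x0 xy y1; apply: annulus => //.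
  - exact: le_lt_trans x0.
  - exact: ltW.
  move=> z /andP[xz zy]; apply: dp.
  - by rewrite (le_trans zy)// ltW.
  - by apply: (cn0 _ x) => //; exact: le_lt_trans x0.
  - by rewrite gt_eqF// (lt_le_trans x0).
(* What remains is the inner part from radius 0 to [rho], which is void if [rho] is 0. *)
have [->//|rhon0] := eqVneq rho 0; have {}rho0 : 0 < rho by rewrite lt_neqAle eq_sym rhon0.
symmetry; apply: M_const_oo => // x y x0 xy y1; apply: annulus => //.
- by rewrite ltW// (lt_trans y1).
move=> z /andP[xz zy]; apply: dp.
- by rewrite (le_trans zy)// ltW// (lt_trans y1).
- exact: cn0 xz.
- by rewrite lt_eqF// (le_lt_trans zy).
Qed.

End CircleMeans.
End MeanValue.

(** * Cauchy's formula on the unit circle *)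

Section ScalarDerivable.
Context {K : numFieldType}.
Implicit Types (f g : K -> K) (z c : K).

Definition cderivable f z := derivable (f : K^o -> K^o) z 1.

Lemma cderivable_cst c z : cderivable (fun=> c) z.
Proof. exact: (@derivable_cst K K^o K^o). Qed.

Lemma cderivable_id z : cderivable id z.
Proof. exact: (@derivable_id K K^o). Qed.

Lemma cderivableD f g z : cderivable f z -> cderivable g z ->
  cderivable (fun x => f x + g x) z.
Proof. exact: (@derivableD K K^o K^o). Qed.

Lemma cderivableB f g z : cderivable f z -> cderivable g z ->
  cderivable (fun x => f x - g x) z.
Proof. exact: (@derivableB K K^o K^o). Qed.

Lemma cderivableM f g z : cderivable f z -> cderivable g z ->
  cderivable (fun x => f x * g x) z.
Proof. exact: (@derivableM K K^o). Qed.

Lemma cderivableV f z : f z != 0 -> cderivable f z ->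
  cderivable (fun x => (f x)^-1) z.
Proof. exact: (@derivableV K K^o). Qed.

Lemma cderivable_sum (I : Type) (r : seq I) (h : I -> K -> K) z :
  (forall i, cderivable (h i) z) -> cderivable (fun x => \sum_(i <- r) h i x) z.
Proof.
move=> hd; elim: r => [|i r IH].
  by under eq_fun do rewrite big_nil; exact: cderivable_cst.
by under eq_fun do rewrite big_cons; exact: cderivableD.
Qed.

Lemma cderivable_prod (I : Type) (r : seq I) (h : I -> K -> K) z :
  (forall i, cderivable (h i) z) -> cderivable (fun x => \prod_(i <- r) h i x) z.
Proof.
move=> hd; elim: r => [|i r IH].
  by under eq_fun do rewrite big_nil; exact: cderivable_cst.
by under eq_fun do rewrite big_cons; exact: cderivableM.
Qed.

Lemma cderivable_near f g z : (\forall x \near (z : K^o), f x = g x) ->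
  cderivable f z -> cderivable g z.
Proof. exact: (@near_eq_derivable K K^o K^o). Qed.

Lemma cderivable_continuous f z : cderivable f z ->
  {for z, continuous (f : K^o -> K^o)}.
Proof. by move=> /derivable1_diffP; exact: differentiable_continuous. Qed.

Lemma pointwise_continuousM f g z :
  {for z, continuous (f : K^o -> K^o)} -> {for z, continuous (g : K^o -> K^o)} ->
  {for z, continuous ((fun x => f x * g x) : K^o -> K^o)}.
Proof.
by move=> cf cg; exact: (@cvgM K _ _ (nbhs_filter (z : K^o)) _ _ _ _ cf cg).
Qed.

Lemma near_neq (z w : K) : z != w -> \forall x \near (z : K^o), x != w.
Proof.
move=> zw; apply/(@nbhs_ballP _ K^o); exists `|z - w|.
  by rewrite /= normr_gt0 subr_eq0.
move=> x; rewrite -ball_normE /ball_/= => zx; apply/eqP => xw.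
by move: zx; rewrite xw ltxx.
Qed.

Lemma cderiveM f g z : cderivable f z -> cderivable g z ->
  'D_1 ((fun x => f x * g x) : K^o -> K^o) z =
  f z * 'D_1 (g : K^o -> K^o) z + g z * 'D_1 (f : K^o -> K^o) z.
Proof. by move=> df dg; rewrite (@deriveM K K^o f g z 1 df dg). Qed.

(** The chain rule for the dilation S(u/s) of [open_disk_pick]. *)
Lemma is_cderive_scale f c z : cderivable f (c * z) ->
  is_derive (z : K^o) 1 ((fun x => f (c * x)) : K^o -> K^o)
    (c * 'D_1 (f : K^o -> K^o) (c * z)).
Proof.
move=> fd; pose g : K^o -> K^o := c *: (id : K^o -> K^o).
have gd : differentiable g (z : K^o) by exact: differentiableZ.
have fd' : differentiable (f : K^o -> K^o) (g z) by exact/derivable1_diffP.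
have fgd : differentiable ((f : K^o -> K^o) \o g) (z : K^o) by exact: differentiable_comp.
split; first exact/derivable1_diffP.
have gz : 'D_1 g (z : K^o) = c *: (1 : K^o).
  by rewrite (deriveZ c (@derivable_id K K^o z 1)) derive_id.
rewrite (deriveE _ gd) in gz.
rewrite (deriveE _ fgd) (diff_comp gd fd') /=.
apply: etrans (congr1 ('d (f : K^o -> K^o) (g z)) gz) _.
by rewrite linearZ/= -deriveE.
Qed.

(** The value at [w] is the derivative, which makes the quotient continuous there. *)
Definition diffq f (w z : K) : K :=
  if z == w then 'D_1 (f : K^o -> K^o) w else (f z - f w) / (z - w).

Lemma diffq_derivable f (w z : K) : z != w -> cderivable f z ->
  cderivable (diffq f w) z.
Proof.
move=> zw fz; apply: (@cderivable_near (fun z => (f z - f w) * (z - w)^-1)).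
  by apply: filterS (near_neq zw) => x xw; rewrite /diffq (negbTE xw).
apply: cderivableM; first by apply: cderivableB => //; exact: cderivable_cst.
apply: cderivableV; first by rewrite subr_eq0.
by apply: cderivableB; [exact: cderivable_id|exact: cderivable_cst].
Qed.

Lemma diffq_continuous f (w : K) : cderivable f w ->
  {for w, continuous (diffq f w : K^o -> K^o)}.
Proof.
move=> fw; apply/(@cvgrPdist_le K K^o K^o (nbhs (w : K^o)) _
  (diffq f w) (diffq f w w : K^o)) => e e0.
have [d d0 H] := derive_eps (derivableP fw) e0.
have -> : diffq f w w = 'D_1 (f : K^o -> K^o) w by rewrite /diffq eqxx.
have : \forall z \near (w : K^o), `|z - w| < d.
  apply/(@nbhs_ballP _ K^o); exists d => //= z.
  by rewrite -ball_normE /ball_/= distrC.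
apply: filterS => z zd; rewrite /diffq; case: eqVneq => [_|zw].
  by rewrite subrr normr0 ltW.
have := H _ zd; rewrite [w + _]addrC subrK => h.
have zw0 : z - w != 0 by rewrite subr_eq0.
have zw1 : 0 < `|z - w| by rewrite normr_gt0.
by rewrite -(ler_pM2r zw1) -normrM mulrBl divfK// -normrN opprB.
Qed.

End ScalarDerivable.

Section CircleMean.
Variable R : realType.
Local Notation C := (R[i]^o).
Implicit Types (f g : R[i] -> R[i]).

Definition circ_cont f := continuous (fun t => f (cis t) : C).

Definition cmean f : R[i] :=
  ((pi *+ 2)^-1 : R)%:C%C * cint 0 (pi *+ 2) (fun t => f (cis t)).

Lemma circ_cont_cst (k : R[i]) : circ_cont (fun=> k).
Proof. by move=> t; exact: cvg_cst. Qed.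

Lemma circ_contD f g : circ_cont f -> circ_cont g ->
  circ_cont (fun z => f z + g z).
Proof. by move=> cf cg t; apply: (@cvgD _ C); [exact: cf|exact: cg]. Qed.

Lemma circ_contM f g : circ_cont f -> circ_cont g ->
  circ_cont (fun z => f z * g z).
Proof. by move=> cf cg t; apply: (@cvgM C); [exact: cf|exact: cg]. Qed.

Lemma circ_contN f : circ_cont f -> circ_cont (fun z => - f z).
Proof.
move=> cf; have -> : (fun z => - f z) = (fun z => (-1) * f z).
  by apply/funext => z; rewrite mulN1r.
exact: (@circ_contM (fun=> -1) f (@circ_cont_cst (-1)) cf).
Qed.

Lemma circ_cont_conj f : circ_cont f -> circ_cont (fun z => (f z)^*).
Proof. by move=> cf t; apply: conj_cvg; exact: cf. Qed.

Lemma circ_cont_sum (I : Type) (r : seq I) (h : I -> R[i] -> R[i]) :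
  (forall i, circ_cont (h i)) -> circ_cont (fun z => \sum_(i <- r) h i z).
Proof.
move=> hc; elim: r => [|i r IH].
  by rewrite /circ_cont; under eq_fun do rewrite big_nil; exact: circ_cont_cst.
rewrite /circ_cont; under eq_fun do rewrite big_cons.
exact: (@circ_contD (h i) (fun z => \sum_(i <- r) h i z) (hc i) IH).
Qed.

Lemma eq_cmean f g : (forall z, cabs z = 1 -> f z = g z) -> cmean f = cmean g.
Proof.
by move=> fg; congr (_ * _); apply: eq_cint => t _; apply: fg; exact: cabs_cis.
Qed.

Lemma cmeanD f g : circ_cont f -> circ_cont g ->
  cmean (fun z => f z + g z) = cmean f + cmean g.
Proof. by move=> cf cg; rewrite /cmean -mulrDr -(cintD _ _ cf cg). Qed.

Lemma cmeanZ (k : R[i]) f : circ_cont f -> cmean (fun z => k * f z) = k * cmean f.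
Proof. by move=> cf; rewrite /cmean (cintZ _ _ k cf) mulrCA. Qed.

Lemma cmeanN f : circ_cont f -> cmean (fun z => - f z) = - cmean f.
Proof. by move=> cf; rewrite /cmean (cintN _ _ cf) mulrN. Qed.

Lemma cmean_conj f : circ_cont f -> cmean (fun z => (f z)^*) = (cmean f)^*.
Proof.
by move=> cf; rewrite /cmean (cint_conj _ _ cf) rmorphM; congr (_ * _); exact/esym/conjc_real.
Qed.

Lemma cmean_sum (I : Type) (r : seq I) (h : I -> R[i] -> R[i]) :
  (forall i, circ_cont (h i)) ->
  cmean (fun z => \sum_(i <- r) h i z) = \sum_(i <- r) cmean (h i).
Proof.
move=> hc; elim: r => [|i r IH].
  rewrite big_nil; transitivity (cmean (fun z => 0 * (fun=> 0) z)).
    by apply: eq_cmean => z _; rewrite big_nil mul0r.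
  by rewrite cmeanZ ?mul0r//; exact: circ_cont_cst.
rewrite big_cons -IH -cmeanD//; last exact: circ_cont_sum.
by apply: eq_cmean => z _; rewrite big_cons.
Qed.

(** Pointwise differentiability on the closed disk, boundary points included, so that means over the
    unit circle see only points under control. *)
Definition disk_analytic f :=
  forall z : R[i], cabs z <= 1 -> cderivable f z.

Lemma disk_circ_cont f :
  (forall z : R[i], cabs z <= 1 -> {for z, continuous (f : C -> C)}) -> circ_cont f.
Proof.
move=> fc t; apply: (@continuous_comp R C C (@cis R) f); first exact: cis_continuous.
by apply: fc; rewrite cabs_cis.
Qed.

Lemma analytic_circ_cont f : disk_analytic f -> circ_cont f.
Proof. by move=> fa; apply: disk_circ_cont => z /fa; exact: cderivable_continuous. Qed.

Lemma cmean_value f (rho : R) : 0 <= rho < 1 ->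
  (forall z : R[i], cabs z <= 1 -> {for z, continuous (f : C -> C)}) ->
  (forall z : R[i], cabs z <= 1 -> z != 0 -> cabs z != rho ->
     cderivable f z) ->
  cmean f = f 0.
Proof.
move=> rho01 fc fd; have := circle_int_mean fc rho01 fd.
rewrite /circle_int /cmean.
have -> : cint 0 (pi *+ 2) (fun t => f (1%:C%C * cis t)) =
          cint 0 (pi *+ 2) (fun t => f (cis t)).
  by apply: eq_cint => t _; rewrite mul1r.
move=> ->; rewrite mulrA -rmorphM mulVf ?mul1r//.
by rewrite mulrn_eq0/= gt_eqF// pi_gt0.
Qed.

Lemma cmean_analytic f : disk_analytic f -> cmean f = f 0.
Proof.
move=> fa; have h01 : (0 : R) <= (0 : R) < 1 by rewrite lexx ltr01.
apply: (cmean_value h01) => [z /fa|z z1 _ _]; last exact: fa.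
exact: cderivable_continuous.
Qed.

End CircleMean.

Section Cauchy.
Variable R : realType.
Local Notation C := (R[i]^o).
Implicit Types (f : R[i] -> R[i]) (w z : R[i]).

Lemma cabs0_eq0 z : (cabs z == 0) = (z == 0).
Proof.
apply/eqP/eqP => [z0|->]; last by rewrite /cabs /= expr0n/= addr0 sqrtr0.
by apply/eqP; rewrite -normr_eq0 cabsE z0.
Qed.

Lemma cabs_conj z : cabs z^* = cabs z.
Proof. by case: z => a b; rewrite /cabs /= sqrrN. Qed.

Lemma circle_conj z : cabs z = 1 -> z^* = z^-1.
Proof.
move=> z1; have z0 : z != 0 by rewrite -cabs0_eq0 z1 oner_eq0.
by apply: (mulfI z0); rewrite divff// -normCK cabsE z1 expr1n.
Qed.

Definition szego w z : R[i] := (1 - z * w^*)^-1.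

Lemma szego_den_neq0 w z : cabs w < 1 -> cabs z <= 1 -> 1 - z * w^* != 0.
Proof.
move=> w1 z1; rewrite subr_eq0; apply/eqP => zw.
have : cabs (z * w^*) < 1.
  by rewrite cabsM cabs_conj (le_lt_trans _ w1)// ler_piMl ?cabs_ge0.
by rewrite -zw /cabs /= expr1n expr0n addr0 sqrtr1 ltxx.
Qed.

Lemma szego_analytic w : cabs w < 1 -> disk_analytic (szego w).
Proof.
move=> w1 z z1; apply: cderivableV; first exact: szego_den_neq0.
apply: cderivableB; first exact: cderivable_cst.
by apply: cderivableM; [exact: cderivable_id|exact: cderivable_cst].
Qed.

Lemma cmean_szego_conj w : cabs w < 1 -> cmean (fun z => (szego w z)^*) = 1.
Proof.
move=> w1; have ka := szego_analytic w1.
rewrite cmean_conj; last exact: analytic_circ_cont.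
by rewrite cmean_analytic// /szego mul0r subr0 invr1 rmorph1.
Qed.

(** On the unit circle the conjugate of the Szego kernel is z / (z - w). The integrand is therefore
    z (f(z) - f(w)) / (z - w), whose mean is its value 0 at the origin, plus f(w) times a function
    of mean 1. The exceptional radius is |w|. *)
Lemma cauchy f w : disk_analytic f -> cabs w < 1 ->
  cmean (fun z => (szego w z)^* * f z) = f w.
Proof.
move=> fa w1; pose p z := z * diffq f w z.
have diffq_cont z : cabs z <= 1 -> {for z, continuous (diffq f w : C -> C)}.
  move=> z1; have [->|zw] := eqVneq z w; first exact/diffq_continuous/fa/ltW.
  by apply: cderivable_continuous; apply: diffq_derivable => //; exact: fa.
have pc z : cabs z <= 1 -> {for z, continuous (p : C -> C)}.
  move=> z1; apply: (@pointwise_continuousM _ id (diffq f w)); last exact: diffq_cont.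
  exact/cderivable_continuous/cderivable_id.
have w01 : 0 <= cabs w < 1 by rewrite cabs_ge0.
have pmean : cmean p = 0.
  rewrite (cmean_value w01 pc) ?/p ?mul0r// => z z1 _ zw.
  apply: cderivableM; first exact: cderivable_id.
  by apply: diffq_derivable; [apply: contraNneq zw => ->|exact: fa].
have kc : circ_cont (fun z => (szego w z)^*).
  exact/circ_cont_conj/analytic_circ_cont/szego_analytic.
have <- : cmean (fun z => p z + f w * (szego w z)^*) = f w.
  have fkc := circ_contM (@circ_cont_cst R (f w)) kc.
  rewrite (cmeanD (disk_circ_cont pc) fkc) (cmeanZ _ kc).
  by rewrite pmean add0r cmean_szego_conj// mulr1.
apply: eq_cmean => z z1.
have zw : z != w by apply: contraTneq w1 => <-; rewrite z1 ltxx.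
have z0 : z != 0 by rewrite -cabs0_eq0 z1 oner_eq0.
have zw0 : z - w != 0 by rewrite subr_eq0.
have -> : (szego w z)^* = z / (z - w).
  transitivity ((1 - z * w^*)^*)^-1; first exact: fmorphV.
  have <- : 1 - z^* * w = (1 - z * w^*)^* by rewrite rmorphB rmorphM rmorph1 /= conjCK.
  rewrite circle_conj//.
  rewrite -invf_div; congr (_^-1).
  by field.
rewrite /p /diffq (negbTE zw); by field.
Qed.

(** On the circle the conjugate of z is 1/z, so the integrand is the difference quotient at 0, with
    mean f'(0), plus f(0) times a function of mean 0. *)
Lemma cauchy_deriv f : disk_analytic f ->
  cmean (fun z => z^* * f z) = 'D_1 (f : C -> C) 0.
Proof.
move=> fa; pose q z := diffq f 0 z.
have qc z : cabs z <= 1 -> {for z, continuous (q : C -> C)}.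
  move=> z1; have [->|zw] := eqVneq z 0.
    by apply: diffq_continuous; apply: fa; rewrite (eqP (_ : cabs 0 == 0)) ?cabs0_eq0.
  by apply: cderivable_continuous; apply: diffq_derivable => //; exact: fa.
have h01 : (0 : R) <= (0 : R) < 1 by rewrite lexx ltr01.
have qmean : cmean q = 'D_1 (f : C -> C) 0.
  rewrite (cmean_value h01 qc) ?/q /diffq ?eqxx// => z z1 z0 _.
  by apply: diffq_derivable => //; exact: fa.
have ida : disk_analytic (@id R[i]) by move=> z _; exact: cderivable_id.
have idc := analytic_circ_cont ida.
have idm : cmean (fun z => z^*) = 0.
  by rewrite (cmean_conj idc) (cmean_analytic ida) rmorph0.
have kc : circ_cont (fun z => z^*) := circ_cont_conj idc.
have <- : cmean (fun z => q z + f 0 * z^*) = 'D_1 (f : C -> C) 0.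
  have fkc := circ_contM (@circ_cont_cst R (f 0)) kc.
  rewrite (cmeanD (disk_circ_cont qc) fkc) (cmeanZ _ kc).
  by rewrite qmean idm mulr0 addr0.
apply: eq_cmean => z z1.
have z0 : z != 0 by rewrite -cabs0_eq0 z1 oner_eq0.
by rewrite circle_conj// /q /diffq (negbTE z0) subr0; field.
Qed.

Lemma cmean_ge0 f : circ_cont f -> (forall z, cabs z = 1 -> 0 <= f z) -> 0 <= cmean f.
Proof.
move=> fc f0.
have Imf t : complex.Im (f (cis t)) = 0.
  by have := f0 _ (cabs_cis t); rewrite lecE => /andP[/eqP].
have Ref t : 0 <= complex.Re (f (cis t)).
  by have := f0 _ (cabs_cis t); rewrite lecE => /andP[].
have := Re_cint_ge0 0 (pi *+ 2) Ref.
rewrite /cmean; have -> : cint 0 (pi *+ 2) (fun t => f (cis t)) =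
   (complex.Re (cint 0 (pi *+ 2) (fun t => f (cis t))))%:C%C.
  (* The integrand equals its conjugate, hence so does the integral, whose imaginary part therefore
     vanishes. *)
  have := cint_conj 0 (pi *+ 2) fc.
  rewrite (@eq_cint _ _ _ _ (fun t => f (cis t))).
    case: (cint _ _ _) => a b; rewrite /= => -[] h; congr (_ +i* _)%C.
    by apply/eqP; have := h; lra.
  by move=> t _; have := Imf t; case: (f _) => a b /= ->; exact: (conjc_real a).
move=> h; rewrite mulr_ge0// ler0c//.
by rewrite invr_ge0 mulrn_wge0// pi_ge0.
Qed.

End Cauchy.

(** * The positivity of Pick matrices *)

Section Adjoint.
Variable C : numClosedFieldType.

Lemma adjM m n p (A : 'M[C]_(m, n)) (B : 'M[C]_(n, p)) :
  (A *m B)^t* = B^t* *m A^t*.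
Proof. by rewrite trmx_mul map_mxM. Qed.

Lemma adjZ m n (a : C) (A : 'M[C]_(m, n)) : (a *: A)^t* = a^* *: A^t*.
Proof. by rewrite linearZ map_mxZ. Qed.

Lemma adjD m n (A B : 'M[C]_(m, n)) : (A + B)^t* = A^t* + B^t*.
Proof. by rewrite linearD map_mxD. Qed.

Lemma adjN m n (A : 'M[C]_(m, n)) : (- A)^t* = - A^t*.
Proof. by rewrite linearN map_mxN. Qed.

Lemma adjB m n (A B : 'M[C]_(m, n)) : (A - B)^t* = A^t* - B^t*.
Proof. by rewrite adjD adjN. Qed.

Lemma adj_sum m n (I : Type) (r : seq I) (F : I -> 'M[C]_(m, n)) :
  (\sum_(i <- r) F i)^t* = \sum_(i <- r) (F i)^t*.
Proof. by rewrite linear_sum /= map_mx_sum. Qed.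

Lemma adjE m n (A : 'M[C]_(m, n)) i j : A^t* i j = (A j i)^*.
Proof. by rewrite !mxE. Qed.

Lemma adj1 n : (1%:M : 'M[C]_n)^t* = 1%:M.
Proof. by rewrite trmx1 map_mx1. Qed.

Lemma adj0 m n : (0 : 'M[C]_(m, n))^t* = 0.
Proof. by rewrite trmx0 map_mx0. Qed.

Lemma adjK m n (A : 'M[C]_(m, n)) : A^t*^t* = A.
Proof. exact: trmxCK. Qed.

Definition sqn m (x : 'cV[C]_m) : C := (x^t* *m x) 0 0.

Lemma sqnE m (x : 'cV[C]_m) : sqn x = \sum_i `|x i 0| ^+ 2.
Proof.
by rewrite /sqn mxE; apply: eq_bigr => i _; rewrite adjE normCK mulrC.
Qed.

Lemma sqn_ge0 m (x : 'cV[C]_m) : 0 <= sqn x.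
Proof. by rewrite sqnE sumr_ge0// => i _; rewrite exprn_ge0. Qed.

Lemma sqn_eq0 m (x : 'cV[C]_m) : (sqn x == 0) = (x == 0).
Proof.
apply/eqP/eqP => [|->]; last by rewrite /sqn mulmx0 mxE.
rewrite sqnE => /eqP; rewrite psumr_eq0 => [/allP x0|i _]; last by rewrite exprn_ge0.
apply/matrixP => i j; rewrite ord1 mxE; apply/eqP.
by have := x0 i (mem_index_enum _); rewrite expf_eq0/= normr_eq0.
Qed.

Lemma sesq_conj m n (x : 'cV[C]_m) (A : 'M[C]_(m, n)) (y : 'cV[C]_n) :
  ((x^t* *m A *m y) 0 0)^* = (y^t* *m A^t* *m x) 0 0.
Proof. by rewrite -adjE !adjM adjK mulmxA. Qed.

Lemma dot_conj m (x y : 'cV[C]_m) : ((x^t* *m y) 0 0)^* = (y^t* *m x) 0 0.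
Proof. by rewrite -adjE adjM adjK. Qed.

End Adjoint.

Section AbstractPick.
Variable R : realType.
Variables (k : nat) (I : finType).
Variables (e : I -> R[i] -> R[i]) (W : I -> 'M[R[i]]_k) (S : R[i] -> 'M[R[i]]_k).
Hypothesis e_an : forall a, disk_analytic (e a).
Hypothesis S_an : forall i j, disk_analytic (fun z => S z i j).
Let G a b := cmean (fun z => (e a z)^* * e b z).
(** Paired with the span of the kernels, the adjoint of multiplication by S sends [e a] times a
    vector x to [e a] times (W a)^* x. *)
Hypothesis ev : forall a b i j,
  cmean (fun z => (e a z)^* * (S z i j * e b z)) = W a i j * G a b.
Hypothesis S_contr : forall z, cabs z = 1 -> forall x : 'cV_k, sqn (S z *m x) <= sqn x.

Let ec a : circ_cont (e a). Proof. exact: analytic_circ_cont. Qed.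
Let ecc a : circ_cont (fun z => (e a z)^*). Proof. exact: circ_cont_conj. Qed.
Let eec a b : circ_cont (fun z => (e a z)^* * e b z).
Proof. exact: circ_contM. Qed.

Let comb (x : I -> 'cV[R[i]]_k) z : 'cV[R[i]]_k := \sum_a e a z *: x a.

Let dot_comb x y z : ((comb x z)^t* *m comb y z) 0 0 =
  \sum_a \sum_b ((x a)^t* *m y b) 0 0 * ((e a z)^* * e b z).
Proof.
rewrite /comb adj_sum mulmx_suml summxE; apply: eq_bigr => a _.
rewrite mulmx_sumr summxE; apply: eq_bigr => b _.
by rewrite adjZ -scalemxAl -scalemxAr scalerA mxE mulrC.
Qed.

Let dot_comb_cont x y : circ_cont (fun z => ((comb x z)^t* *m comb y z) 0 0).
Proof.
rewrite (funext (dot_comb x y)); do 2!apply: circ_cont_sum => ?.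
by apply: circ_contM; [exact: circ_cont_cst|exact: eec].
Qed.

Let cmean_dot x y : cmean (fun z => ((comb x z)^t* *m comb y z) 0 0) =
  \sum_a \sum_b ((x a)^t* *m y b) 0 0 * G a b.
Proof.
rewrite (@eq_cmean _ _
  (fun z => \sum_a \sum_b ((x a)^t* *m y b) 0 0 * ((e a z)^* * e b z))).
  rewrite (@cmean_sum _ _ _
    (fun a z => \sum_b ((x a)^t* *m y b) 0 0 * ((e a z)^* * e b z))).
    apply: eq_bigr => a _.
    rewrite (@cmean_sum _ _ _ (fun b z => ((x a)^t* *m y b) 0 0 * ((e a z)^* * e b z))).
      by apply: eq_bigr => b _; rewrite cmeanZ.
    by move=> b; apply: circ_contM => //; exact: circ_cont_cst.
  move=> a; apply: circ_cont_sum => b.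
  by apply: circ_contM => //; exact: circ_cont_cst.
by move=> z _; exact: dot_comb.
Qed.

Let dotS_comb x y z : ((comb x z)^t* *m (S z *m comb y z)) 0 0 =
  \sum_a \sum_b \sum_i \sum_j
     ((x a i 0)^* * y b j 0) * ((e a z)^* * (S z i j * e b z)).
Proof.
rewrite /comb adj_sum mulmx_suml summxE; apply: eq_bigr => a _.
rewrite !mulmx_sumr summxE; apply: eq_bigr => b _.
rewrite adjZ -scalemxAl -!scalemxAr scalerA !mxE big_distrr/=; apply: eq_bigr => i _.
rewrite adjE !mxE !big_distrr/=; apply: eq_bigr => j _.
by ring.
Qed.

Let eSe a b i j : circ_cont (fun z => (e a z)^* * (S z i j * e b z)).
Proof.
apply: circ_contM => //; apply: circ_contM => //; apply: analytic_circ_cont; exact: S_an.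
Qed.

Let dotS_cont x y : circ_cont (fun z => ((comb x z)^t* *m (S z *m comb y z)) 0 0).
Proof.
rewrite (funext (dotS_comb x y)); do 4!apply: circ_cont_sum => ?.
by apply: circ_contM; [exact: circ_cont_cst|exact: eSe].
Qed.

Let cmean_dotS x y : cmean (fun z => ((comb x z)^t* *m (S z *m comb y z)) 0 0) =
  \sum_a \sum_b ((x a)^t* *m W a *m y b) 0 0 * G a b.
Proof.
pose t a b i j z := ((x a i 0)^* * y b j 0) * ((e a z)^* * (S z i j * e b z)).
have tc a b i j : circ_cont (t a b i j).
  by apply: circ_contM; [exact: circ_cont_cst|exact: eSe].
rewrite (@eq_cmean _ _ (fun z => \sum_a \sum_b \sum_i \sum_j t a b i j z)); last first.
  by move=> z _; exact: dotS_comb.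
rewrite (@cmean_sum _ _ _ (fun a z => \sum_b \sum_i \sum_j t a b i j z)); last first.
  by move=> a; do 3!apply: circ_cont_sum => ?.
apply: eq_bigr => a _.
rewrite (@cmean_sum _ _ _ (fun b z => \sum_i \sum_j t a b i j z)); last first.
  by move=> b; do 2!apply: circ_cont_sum => ?.
apply: eq_bigr => b _.
rewrite (@cmean_sum _ _ _ (fun i z => \sum_j t a b i j z)); last first.
  by move=> i; apply: circ_cont_sum => ?.
rewrite -mulmxA mxE big_distrl/=; apply: eq_bigr => i _.
rewrite (@cmean_sum _ _ _ (fun j z => t a b i j z)); last exact: tc.
rewrite adjE mxE big_distrr big_distrl/=; apply: eq_bigr => j _.
by rewrite cmeanZ// ev; ring.
Qed.

(* With [h = sum e_b x_b] and [u = sum e_b W_b^* x_b], the mean of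
   [|h - S u|^2] is at most [|h|^2 - 2 |u|^2 + |u|^2]. *)
Lemma abstract_pick (x : I -> 'cV[R[i]]_k) :
  0 <= \sum_a \sum_b ((x a)^t* *m (1%:M - W a *m (W b)^t*) *m x b) 0 0 * G a b.
Proof.
pose y b := (W b)^t* *m x b.
pose H := \sum_a \sum_b ((x a)^t* *m x b) 0 0 * G a b.
pose U := \sum_a \sum_b ((y a)^t* *m y b) 0 0 * G a b.
have -> : \sum_a \sum_b ((x a)^t* *m (1%:M - W a *m (W b)^t*) *m x b) 0 0 * G a b = H - U.
  rewrite -sumrB; apply: eq_bigr => a _; rewrite -sumrB; apply: eq_bigr => b _.
  rewrite -mulrBl; congr (_ * _).
  by rewrite mulmxBr mulmx1 mulmxBl /y adjM adjK !mulmxA !mxE.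
pose dh z := ((comb x z)^t* *m comb x z) 0 0.
pose du z := ((comb y z)^t* *m comb y z) 0 0.
pose ds z := ((comb x z)^t* *m (S z *m comb y z)) 0 0.
have Hm : cmean dh = H by exact: cmean_dot.
have Um : cmean du = U by exact: cmean_dot.
have Sm : cmean ds = U.
  rewrite /ds cmean_dotS; apply: eq_bigr => a _; apply: eq_bigr => b _.
  by rewrite /y adjM adjK.
have dsc : circ_cont ds by exact: dotS_cont.
have dhc : circ_cont dh by exact: dot_comb_cont.
have duc : circ_cont du by exact: dot_comb_cont.
have dsC := circ_cont_conj dsc.
have UC : U^* = U.
  rewrite -Um -cmean_conj//; apply: eq_cmean => z _.
  by rewrite /du dot_conj.
suff : 0 <= cmean (fun z => (dh z + - ds z) + (- (ds z)^* + du z)).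
  rewrite (cmeanD (circ_contD dhc (circ_contN dsc)) (circ_contD (circ_contN dsC) duc)).
  rewrite (cmeanD dhc (circ_contN dsc)) (cmeanD (circ_contN dsC) duc) !cmeanN//.
  by rewrite cmean_conj// Hm Sm Um UC addNr addr0.
apply: cmean_ge0.
  exact: (circ_contD (circ_contD dhc (circ_contN dsc)) (circ_contD (circ_contN dsC) duc)).
move=> z z1.
have h1 : sqn (comb x z - S z *m comb y z) =
   dh z - ds z - (ds z)^* + sqn (S z *m comb y z).
  rewrite /sqn adjB mulmxBl !mulmxBr /dh /ds dot_conj !mxE.
  by ring.
apply: le_trans (sqn_ge0 (comb x z - S z *m comb y z)) _.
rewrite h1 addrA lerD2l.
exact: S_contr.
Qed.

End AbstractPick.

(** * Differentiation of matrix functions, entry by entry *)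

Section MatrixDerivable.
Context {K : numFieldType} {m n : nat}.
Implicit Types (S : K^o -> 'M[K]_(m, n)) (z : K).

Lemma is_derive_entry S z i j : derivable S z 1 ->
  is_derive (z : K^o) 1 ((fun x => S x i j) : K^o -> K^o) ('D_1 S z i j).
Proof.
move=> Sd.
have H : (fun h : K^o => h^-1 *: ((S (h *: (1 : K^o) + z) i j : K^o) - S z i j)) @ 0^' -->
   ('D_1 S z i j : K^o).
  have -> : (fun h : K^o => h^-1 *: ((S (h *: (1 : K^o) + z) i j : K^o) - S z i j)) =
    (fun M : 'M[K]_(m, n) => M i j : K^o) \o
    (fun h : K^o => h^-1 *: (S (h *: (1 : K^o) + z) - S z)).
    by apply/funext => h /=; rewrite !mxE.
  apply: (@cvg_comp _ _ _ _ _ _ (nbhs ('D_1 S z))); first exact: Sd.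
  exact: coord_continuous.
split; first by apply/cvg_ex; exists ('D_1 S z i j).
by apply: cvg_lim H.
Qed.

Lemma is_derive_mx S z (D : 'M[K]_(m, n)) :
  (forall i j, is_derive (z : K^o) 1 ((fun x => S x i j) : K^o -> K^o) (D i j)) ->
  is_derive (z : K^o) 1 S D.
Proof.
move=> SD.
have H : (fun h : K^o => h^-1 *: (S (h *: (1 : K^o) + z) - S z)) @ 0^' --> D.
  apply/cvg_ballP => eps eps0.
  have : \forall h \near (0 : K^o)^', forall ij : 'I_m * 'I_n,
     ball (D ij.1 ij.2 : K^o) eps ((h^-1 *: (S (h *: (1 : K^o) + z) - S z)) ij.1 ij.2 : K^o).
    apply: filter_forall => -[i j] /=.
    have [d <-] := SD i j.
    have /cvg_ballP /(_ _ eps0) := d.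
    by apply: filterS => h; rewrite !mxE.
  by apply: filterS => h hb; split=> // i j; exact: (hb (i, j)).
split; first by apply/cvg_ex; exists D.
by apply: cvg_lim H.
Qed.
End MatrixDerivable.

(** * Contractive matrices *)

Section OperatorNorm.
Variable R : realType.
Variable k : nat.
Implicit Types (x : 'cV[R[i]]_k) (A : 'M[R[i]]_k).

Lemma enorm_ge0 x : 0 <= enorm x.
Proof. exact: sqrtr_ge0. Qed.

Lemma sqn_enorm x : sqn x = ((enorm x) ^+ 2)%:C%C.
Proof.
rewrite /enorm sqr_sqrtr; last by rewrite sumr_ge0// => i _; rewrite sqr_ge0.
rewrite sqnE rmorph_sum; apply: eq_bigr => i _.
by rewrite rmorphXn.
Qed.

Lemma enorm_le x (y : 'cV[R[i]]_k) : (enorm x <= enorm y) = (sqn x <= sqn y).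
Proof.
by rewrite !sqn_enorm lecR ler_pXn2r// nnegrE enorm_ge0.
Qed.

Lemma enormZ (c : R) x : 0 <= c -> enorm (c%:C%C *: x) = c * enorm x.
Proof.
move=> c0; apply/eqP; rewrite -(@eqrXn2 _ 2)// ?mulr_ge0 ?enorm_ge0//.
apply/eqP; apply: complexI; rewrite -sqn_enorm sqnE exprMn rmorphM/= -sqn_enorm sqnE.
rewrite big_distrr/=; apply: eq_bigr => i _.
by rewrite mxE normrM exprMn rmorphXn/= cabsE cabs_real ger0_norm.
Qed.

Lemma cabs_le_enorm x i : cabs (x i 0) <= enorm x.
Proof.
rewrite -(@ler_pXn2r _ 2)// ?nnegrE ?cabs_ge0 ?enorm_ge0//.
rewrite -lecR -sqn_enorm sqnE (bigD1 i)//= rmorphXn/= -cabsE lerDl.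
by rewrite sumr_ge0// => j _; rewrite exprn_ge0.
Qed.

(** The real [sup] is 0 on an unbounded set, so [opnorm] bounds nothing until boundedness is known.
    The crude bound uses that each coordinate of x has modulus at most 1. *)
Lemma opnorm_has_sup A :
  has_sup [set enorm (A *m x) | x in [set x | enorm x <= 1]].
Proof.
split.
  exists (enorm (A *m 0)), 0 => //=.
  rewrite /enorm big1 ?sqrtr0 ?ler01// => i _.
  by rewrite mxE normr0 expr0n.
pose B := \sum_i (\sum_j cabs (A i j)) ^+ 2.
have B0 : 0 <= B by rewrite sumr_ge0// => i _; rewrite sqr_ge0.
exists (Num.sqrt B) => _ [x /= x1 <-].
rewrite ler_wsqrtr// ler_sum// => i _; rewrite ler_pXn2r ?nnegrE ?cabs_ge0//; last first.
  by rewrite sumr_ge0// => j _; rewrite cabs_ge0.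
rewrite -lecR -cabsE mxE (le_trans (ler_norm_sum _ _ _))// rmorph_sum/= ler_sum// => j _.
by rewrite normrM ler_piMr// cabsE lecR (le_trans (cabs_le_enorm _ _)).
Qed.

Lemma opnorm_le1P A : opnorm A <= 1 <-> forall x, sqn (A *m x) <= sqn x.
Proof.
split=> [A1 x|Ax].
  rewrite -enorm_le; have [x0|xn0] := eqVneq (enorm x) 0.
    have : sqn x == 0 by rewrite sqn_enorm x0 expr0n.
    by rewrite sqn_eq0 => /eqP ->; rewrite mulmx0.
  have xp : 0 < enorm x by rewrite lt_neqAle eq_sym xn0 enorm_ge0.
  have ip : 0 <= (enorm x)^-1 by rewrite invr_ge0 ltW.
  have : enorm (A *m ((enorm x)^-1%:C%C *: x)) <= 1.
    apply: le_trans A1; apply: ub_le_sup; first exact: (opnorm_has_sup A).2.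
    by exists ((enorm x)^-1%:C%C *: x) => //=; rewrite enormZ// mulVf.
  by rewrite -scalemxAr enormZ// mulrC ler_pdivrMr// mul1r.
apply: ge_sup; first exact: (opnorm_has_sup A).1.
move=> _ [x /= x1 <-]; apply: le_trans x1; rewrite enorm_le; exact: Ax.
Qed.

Lemma disk_supnorm_le1P (S : R[i] -> 'M[R[i]]_k) : (disk_supnorm S <= 1%:E)%E <->
  forall z, cabs z < 1 -> forall x, sqn (S z *m x) <= sqn x.
Proof.
split=> [S1 z z1|S1].
  apply/opnorm_le1P; rewrite -lee_fin; apply: le_trans S1; apply: ereal_sup_ubound.
  by exists z => //; rewrite /unit_disk/= -[1]/(1%:C%C) ltc_norm.
apply: ge_ereal_sup => _ [z zD <-]; rewrite lee_fin; apply/opnorm_le1P; apply: S1.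
by move: zD; rewrite /unit_disk/= -[1 : R[i]]/(1%:C%C) ltc_norm.
Qed.

End OperatorNorm.

(** * Necessity *)

Section PointwiseLimits.
Context {K : numFieldType} {T : Type} {F : set_system T} {FF : Filter F}.
Implicit Types f g : T -> K.

Lemma pointwise_cvgD f g (a b : K) : f @ F --> (a : K^o) -> g @ F --> (b : K^o) ->
  (fun t => f t + g t) @ F --> (a + b : K^o).
Proof. exact: (@cvgD K K^o). Qed.

Lemma pointwise_cvgB f g (a b : K) : f @ F --> (a : K^o) -> g @ F --> (b : K^o) ->
  (fun t => f t - g t) @ F --> (a - b : K^o).
Proof. exact: (@cvgB K K^o). Qed.

Lemma pointwise_cvgM f g (a b : K) : f @ F --> (a : K^o) -> g @ F --> (b : K^o) ->
  (fun t => f t * g t) @ F --> (a * b : K^o).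
Proof. exact: (@cvgM K). Qed.

Lemma pointwise_cvgV f (a : K) : a != 0 -> f @ F --> (a : K^o) ->
  (fun t => (f t)^-1) @ F --> (a^-1 : K^o).
Proof. exact: (@cvgV K). Qed.

Lemma pointwise_cvg_cst (a : K) : (fun=> a) @ F --> (a : K^o).
Proof. exact: (@cvg_cst K^o). Qed.

Lemma pointwise_cvg_sum (I : Type) (r : seq I) (f : I -> T -> K) (l : I -> K) :
  (forall i, f i @ F --> (l i : K^o)) ->
  (fun t => \sum_(i <- r) f i t) @ F --> (\sum_(i <- r) l i : K^o).
Proof.
move=> fl; elim: r => [|i r IH].
  rewrite big_nil (_ : (fun t => _) = (fun=> 0)); first exact: pointwise_cvg_cst.
  by apply/funext => t; rewrite big_nil.
rewrite big_cons (_ : (fun t => _) = (fun t => f i t + \sum_(i <- r) f i t)).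
  exact: pointwise_cvgD.
by apply/funext => t; rewrite big_cons.
Qed.

End PointwiseLimits.

Section CaratheodoryPick.
Variable R : realType.
Variables (k n : nat).
Local Notation C := (R[i]^o).
Local Notation idx := ('I_n + bool)%type.

(* Gram matrix, in the Hardy space, of the representers of the functionals
   [f |-> f (w j)] (index [inl j]), [f |-> f 0] ([inr false]) and
   [f |-> f'(0)] ([inr true]). *)
Definition pick_kernel (w : 'I_n -> R[i]) (a b : idx) : R[i] :=
  match a, b with
  | inl i, inl j => (1 - w i * (w j)^*)^-1
  | inl i, inr false => 1
  | inl i, inr true => w i
  | inr false, inl j => 1
  | inr true, inl j => (w j)^*
  | inr p, inr q => (p == q)%:R
  end.

(** Both indices [inr _] get S(0): when S'(0) = 0, the functional f'(0) is also multiplied by S(0)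
    when f is replaced by S f. *)
Definition pick_value (w : 'I_n -> R[i]) (S : R[i] -> 'M[R[i]]_k) (a : idx) :=
  if a is inl j then S (w j) else S 0.

Let base (w : 'I_n -> R[i]) (a : idx) (z : R[i]) : R[i] :=
  match a with inl j => szego (w j) z | inr false => 1 | inr true => z end.

Lemma cabs0 : cabs (0 : R[i]) = 0.
Proof. by apply/eqP; rewrite cabs0_eq0. Qed.

Section ClosedDisk.
Variables (w : 'I_n -> R[i]) (S : R[i] -> 'M[R[i]]_k).
Hypothesis w1 : forall j, cabs (w j) < 1.
Hypothesis S_an : forall i j, disk_analytic (fun z => S z i j).
Hypothesis S'0 : forall i j, 'D_1 ((fun z => S z i j) : C -> C) 0 = 0.

Let base_an a : disk_analytic (base w a).
Proof.
case: a => [j|[]]; first exact: szego_analytic.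
- by move=> z _; exact: cderivable_id.
- by move=> z _; exact: cderivable_cst.
Qed.

Let Sbase_an a i j : disk_analytic (fun z => S z i j * base w a z).
Proof. by move=> z z1; apply: cderivableM; [exact: S_an|exact: base_an]. Qed.

Let functional a f : disk_analytic f ->
  cmean (fun z => (base w a z)^* * f z) =
  match a with
  | inl j => f (w j) | inr false => f 0 | inr true => 'D_1 (f : C -> C) 0
  end.
Proof.
case: a => [j|[]] fa /=.
- exact: cauchy.
- exact: cauchy_deriv.
- rewrite -cmean_analytic//; apply: eq_cmean => z _.
  by rewrite rmorph1 mul1r.
Qed.

Let gram a b := cmean (fun z => (base w a z)^* * base w b z).

Let gram_conj a b : (gram a b)^* = gram b a.
Proof.
rewrite /gram -cmean_conj; last first.
  apply: circ_contM; last exact: analytic_circ_cont.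
  by apply: circ_cont_conj; exact: analytic_circ_cont.
by apply: eq_cmean => z _; rewrite rmorphM /= conjCK mulrC.
Qed.

Let gramE a b : gram a b = pick_kernel w a b.
Proof.
have gl j c : gram (inl j) c = base w c (w j) by rewrite /gram functional.
have g0 c : gram (inr false) c = base w c 0 by rewrite /gram functional.
case: a => [i|[]].
- by rewrite gl; case: b => [j|[]].
- case: b => [j|[]].
  + by rewrite -gram_conj gl.
  + rewrite /gram functional//=; exact: (@derive_id R[i] C).
  + by rewrite -gram_conj g0 /= rmorph0.
- rewrite g0; case: b => [j|[]] //=.
  by rewrite /szego mul0r subr0 invr1.
Qed.

(** The reproducing property applied to an entry of S times a kernel. Only the derivative functional
    produces a second term, and S'(0) = 0 kills it. *)
Let value_mult a b i j : cmean (fun z => (base w a z)^* * (S z i j * base w b z)) =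
  pick_value w S a i j * gram a b.
Proof.
rewrite /gram !functional//; case: a => [l|[]] //=.
have z01 : cabs (0 : R[i]) <= 1 by rewrite cabs0.
by rewrite (cderiveM (@S_an i j 0 z01) (@base_an b 0 z01)) S'0 mulr0 addr0.
Qed.

Lemma closed_disk_pick (x : idx -> 'cV[R[i]]_k) :
  (forall z, cabs z = 1 -> forall y : 'cV_k, sqn (S z *m y) <= sqn y) ->
  0 <= \sum_a \sum_b ((x a)^t* *m (1%:M - pick_value w S a *m (pick_value w S b)^t*)
         *m x b) 0 0 * pick_kernel w a b.
Proof.
move=> Sc; have := abstract_pick base_an S_an value_mult Sc x.
by under eq_bigr => a _ do under eq_bigr => b _ do rewrite -/(gram a b) gramE.
Qed.

End ClosedDisk.

(** In the partial order of [R[i]], being nonnegative includes being real, so both components are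
    controlled in the limit. *)
Lemma cvg_ge0 (T : Type) (F : set_system T) (FF : ProperFilter F) (f : T -> C) (l : C) :
  f @ F --> l -> (\forall t \near F, 0 <= f t) -> 0 <= l.
Proof.
move=> /cvg_cabsP fl f0.
have near_l e : 0 < e -> exists2 v : R[i], 0 <= v & cabs (l - v) < e.
  move=> e0; have [t [/= ft0 lt]] := filter_ex (filterI f0 (fl e e0)).
  by exists (f t).
rewrite lecE; apply/andP; split.
  apply/negPn/negP => Il; have e0 : 0 < `|complex.Im l| by rewrite normr_gt0.
  have [v v0] := near_l _ e0; rewrite ltNge => /negP; apply.
  apply: le_trans (cabs_Im _); rewrite raddfB/=.
  by have := v0; rewrite lecE => /andP[/eqP -> _]; rewrite subr0.
rewrite leNgt; apply/negP => Rl; have e0 : 0 < - complex.Re l by rewrite oppr_gt0.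
have [v v0] := near_l _ e0; rewrite ltNge => /negP; apply.
apply: le_trans (cabs_Re _); rewrite raddfB/= -normrN opprB.
have v1 : 0 <= complex.Re v by have := v0; rewrite lecE => /andP[].
by rewrite (le_trans _ (ler_norm _))// lerDr.
Qed.

Section OpenDisk.
Variables (z : 'I_n -> R[i]) (S : R[i] -> 'M[R[i]]_k).
Hypothesis z1 : forall j, cabs (z j) < 1.
Hypothesis S_hol : forall i j (u : R[i]), cabs u < 1 -> cderivable (fun u => S u i j) u.
Hypothesis S'0 : forall i j, 'D_1 ((fun u => S u i j) : C -> C) 0 = 0.
Hypothesis Sc : forall u, cabs u < 1 -> forall y : 'cV_k, sqn (S u *m y) <= sqn y.

Let pick_kernel_cvg a b :
  (fun s : R => pick_kernel (fun j => s%:C%C * z j) a b : C) @ (1 : R)^'+ -->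
  (pick_kernel z a b : C).
Proof.
have lin c : (fun s : R => s%:C%C * c : C) @ (1 : R)^'+ --> (c : C).
  rewrite -[X in _ --> X](mul1r c); apply: pointwise_cvgM.
    apply: cvg_at_right_filter; exact: (@real_cvg _ id 1 cvg_id).
  exact: pointwise_cvg_cst.
case: a => [i|[]]; case: b => [j|[]] /=; try exact: pointwise_cvg_cst.
- apply: pointwise_cvgV.
    by apply: szego_den_neq0 => //; exact: ltW.
  apply: pointwise_cvgB; first exact: pointwise_cvg_cst.
  by apply: pointwise_cvgM; [exact: lin|apply: conj_cvg; exact: lin].
- exact: lin.
- by apply: conj_cvg; exact: lin.
Qed.

(* Apply the closed disk case to [S (u / s)] at the points [s z_j], [s > 1],
   and let [s] tend to [1]. *)
Lemma open_disk_pick (x : idx -> 'cV[R[i]]_k) :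
  0 <= \sum_a \sum_b ((x a)^t* *m (1%:M - pick_value z S a *m (pick_value z S b)^t*)
         *m x b) 0 0 * pick_kernel z a b.
Proof.
pose c a b := ((x a)^t* *m (1%:M - pick_value z S a *m (pick_value z S b)^t*) *m x b) 0 0.
apply: (@cvg_ge0 R (1 : R)^'+ _
   (fun s => \sum_a \sum_b c a b * pick_kernel (fun j => s%:C%C * z j) a b)).
  apply: pointwise_cvg_sum => a; apply: pointwise_cvg_sum => b.
  by apply: pointwise_cvgM; [exact: pointwise_cvg_cst|exact: pick_kernel_cvg].
have near1 : \forall s \near (1 : R)^'+, forall j, s * cabs (z j) < 1.
  apply: filter_forall => j.
  have H : (fun s : R => s * cabs (z j)) @ (1 : R)^'+ --> 1 * cabs (z j).
    by apply: cvg_at_right_filter; apply: cvgM; [exact: cvg_id|exact: cvg_cst].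
  rewrite mul1r in H.
  exact: (cvgr_lt (cabs (z j)) H).
near=> s.
have s1 : 1 < s by [].
have s0 : 0 < s by rewrite (lt_trans _ s1).
have sV : s^-1 < 1 by rewrite invf_lt1.
have sz : forall j, s * cabs (z j) < 1 by near: s.
pose T u := S (s^-1%:C%C * u).
have sin u : cabs u <= 1 -> cabs (s^-1%:C%C * u) < 1.
  move=> u1; rewrite cabsM cabs_real ger0_norm ?invr_ge0 ?(ltW s0)//.
  by rewrite (le_lt_trans _ sV)// ler_piMr ?invr_ge0 ?(ltW s0).
have wz j : cabs (s%:C%C * z j) < 1 by rewrite cabsM cabs_real gtr0_norm.
have Ta i j : disk_analytic (fun u => T u i j).
  move=> u u1; have [] := is_cderive_scale (@S_hol i j _ (sin u u1)); exact.
have T0 i j : 'D_1 ((fun u => T u i j) : C -> C) 0 = 0.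
  have c0 : cabs (0 : R[i]) <= 1 by rewrite cabs0.
  have [_] := is_cderive_scale (@S_hol i j _ (sin 0 c0)).
  by rewrite mulr0 S'0 mulr0.
have := @closed_disk_pick _ T wz Ta T0 x _.
(* The dilation cancels at the moved nodes, so the coefficients of the form do not depend on [s]. *)
have -> : pick_value (fun j => s%:C%C * z j) T = pick_value z S.
  apply/funext => -[j|b]; rewrite /pick_value /T ?mulr0//.
  by rewrite mulrA -rmorphM mulVf ?mul1r// gt_eqF.
by apply=> u u1 y; apply: Sc; apply: sin; rewrite u1.
Unshelve. all: end_near. Qed.

End OpenDisk.
End CaratheodoryPick.

(** * Hermitian symmetry from nonnegativity of a form *)

Section Hermitian.
Variable C : numClosedFieldType.

Lemma entryD m n (A B : 'M[C]_(m, n)) i j : (A + B) i j = A i j + B i j.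
Proof. by rewrite mxE. Qed.

Lemma entryB m n (A B : 'M[C]_(m, n)) i j : (A - B) i j = A i j - B i j.
Proof. by rewrite !mxE. Qed.

Lemma entryZ m n (a : C) (A : 'M[C]_(m, n)) i j : (a *: A) i j = a * A i j.
Proof. by rewrite mxE. Qed.

Lemma sqn_add_adjM m p (s : 'cV[C]_p) (X : 'M_(m, p)) (t : 'cV_m) :
  sqn (s + X^t* *m t) = sqn s + (s^t* *m X^t* *m t) 0 0 + (t^t* *m X *m s) 0 0
    + (t^t* *m (X *m X^t*) *m t) 0 0.
Proof.
rewrite /sqn adjD adjM adjK mulmxDl !mulmxDr !mulmxA !entryD.
by rewrite !addrA.
Qed.

(* Nonnegativity in the order of [C] forces the form to be real-valued;
   polarize. *)
Lemma form_ge0_hermitian m (A : 'M[C]_m) :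
  (forall x : 'cV_m, 0 <= (x^t* *m A *m x) 0 0) -> A \is hermsymmx.
Proof.
move=> A0; have [B BE0] : exists B, B = A - A^t* by exists (A - A^t*).
have B0 (x : 'cV_m) : (x^t* *m B *m x) 0 0 = 0.
  rewrite BE0 mulmxBr mulmxBl entryB -sesq_conj conj_Creal ?subrr//.
  exact/ger0_real.
(* At c = 1 this makes B antisymmetric, at c = i symmetric; together B = 0. *)
have BE (c : C) i j : c * B i j + c^* * B j i = 0.
  have D (s t : 'I_m) :
      ((delta_mx s 0 : 'cV[C]_m)^t* *m B *m (delta_mx t 0 : 'cV[C]_m)) 0 0 = B s t.
    rewrite trmx_delta map_delta_mx.
    rewrite -rowE mxE (bigD1 t)//= big1 ?addr0 => [|l /negbTE jt].
      by rewrite !mxE !eqxx mulr1.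
    by rewrite !mxE jt mulr0.
  have := B0 (delta_mx i 0 + c *: delta_mx j 0).
  rewrite adjD adjZ !mulmxDl !mulmxDr -!scalemxAl -!scalemxAr.
  have Bii s : B s s = 0 by rewrite -D B0.
  rewrite !(entryD, entryZ). rewrite !D !Bii !mulr0 add0r addr0.
  by rewrite addrC.
apply/is_hermitianmxP; rewrite expr0 scale1r; apply/eqP; rewrite -subr_eq0.
apply/eqP; rewrite -BE0; apply/matrixP => i j; rewrite [RHS]mxE.
have h1 := BE 1 i j; rewrite rmorph1 !mul1r in h1.
have h2 := BE 'i i j; rewrite conjCi mulNr -mulrBr in h2.
have {h2}/eqP : 'i * (B i j - B j i) = 0 by [].
rewrite mulf_eq0 (negbTE (neq0Ci _))/= subr_eq0 => /eqP h3.
move: h1; rewrite -h3 -mulr2n => /eqP; rewrite mulrn_eq0/= => /eqP.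
by [].
Qed.
End Hermitian.

Lemma sum_ord_bool (V : comNzRingType) (n : nat) (F : 'I_n + bool -> 'I_n + bool -> V) :
  \sum_a \sum_b F a b =
    \sum_i \sum_j F (inl i) (inl j)
    + \sum_i F (inl i) (inr true) + \sum_i F (inl i) (inr false)
    + \sum_i F (inr true) (inl i) + \sum_i F (inr false) (inl i)
    + (F (inr true) (inr true) + F (inr true) (inr false)
       + (F (inr false) (inr true) + F (inr false) (inr false))).
Proof.
rewrite big_sumType /= big_bool /= !big_sumType /= !big_bool /=.
under eq_bigr => i _ do rewrite big_sumType /= big_bool /=.
rewrite !big_split /=; ring.
Qed.

(** * The quadratic form of the extended matrix *)

Section QuadraticForm.
Variables (R : realType) (k n : nat).
Variables (z : 'I_n -> R[i]) (W : 'I_n -> 'M[R[i]]_k) (X : 'M[R[i]]_k).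

Let B i : 'M[R[i]]_k := 1%:M - W i *m X^t*.

Lemma Emx_sub : Emx R k n - Wmx W *m X^t* = \mxcol_i B i.
Proof. by rewrite /Emx /Wmx mxcol_mul -mxcolB. Qed.

Lemma Zmx_mxcol m (D : 'I_n -> 'M[R[i]]_(k, m)) :
  Zmx k z *m (\mxcol_i D i) = \mxcol_i (z i *: D i).
Proof.
by rewrite /Zmx mul_mxdiag_mxcol; apply: eq_mxcol => i; rewrite mul_scalar_mx.
Qed.

Lemma adj_mxcol m (D : 'I_n -> 'M[R[i]]_(k, m)) :
  (\mxcol_i D i)^t* = \mxrow_i ((D i)^t*).
Proof. by apply/matrixP => i j; rewrite !mxE. Qed.

Lemma adj_Emx_sub : (Emx R k n)^t* - X *m (Wmx W)^t* = (Emx R k n - Wmx W *m X^t*)^t*.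
Proof. by rewrite adjB adjM adjK. Qed.

Let xs (x : 'I_n -> 'cV[R[i]]_k) (y y' : 'cV[R[i]]_k) (a : 'I_n + bool) :=
  match a with inl i => x i | inr false => y | inr true => y' end.

Let Ws (a : 'I_n + bool) := if a is inl j then W j else X.

Let form m p (a : 'cV[R[i]]_m) (A : 'M_(m, p)) (b : 'cV_p) := (a^t* *m A *m b) 0 0.

Lemma pick_mx_form (x : 'I_n -> 'cV[R[i]]_k) :
  (\mxrow_i (x i)^t* *m pick_mx z W *m \mxcol_i x i) 0 0 =
  \sum_i \sum_j form (x i) (1%:M - W i *m (W j)^t*) (x j) * (1 - z i * (z j)^*)^-1.
Proof.
rewrite /pick_mx mul_mxrow_mxblock mul_mxrow_mxcol summxE exchange_big.
apply: eq_bigr => j _; rewrite mulmx_suml summxE; apply: eq_bigr => i _.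
by rewrite -scalemxAr -scalemxAl entryZ mulrC.
Qed.

Lemma pick_ext_blocks (x : 'I_n -> 'cV[R[i]]_k) (y y' v v' : 'cV[R[i]]_k) :
  let u := col_mx (\mxcol_i x i) (col_mx y (col_mx y' (col_mx v v'))) in
  (u^t* *m pick_ext_mx z W X *m u) 0 0 =
  \sum_i \sum_j form (x i) (1%:M - W i *m (W j)^t*) (x j) * (1 - z i * (z j)^*)^-1
  + \sum_i form (x i) (B i) y + \sum_i form (x i) (B i) y' * z i
  + \sum_i form y ((B i)^t*) (x i) + \sum_i form y' ((B i)^t*) (x i) * (z i)^*
  + (sqn y + form y X v + form v (X^t*) y + sqn v)
  + (sqn y' + form y' X v' + form v' (X^t*) y' + sqn v').
Proof.
move=> u; rewrite /u /pick_ext_mx /row_mx5 -mulmxA !mul_col_mx !mul_row_col.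
rewrite !tr_col_mx !map_row_mx !mul_row_col !mul0mx !mul1mx !addr0 !add0r.
rewrite adj_Emx_sub -!adjM Emx_sub Zmx_mxcol !adj_mxcol.
rewrite !mulmxDr !mulmxA !entryD pick_mx_form.
have e1 : (\mxrow_i (x i)^t* *m \mxcol_i B i *m y) 0 0 = \sum_i form (x i) (B i) y.
  by rewrite mul_mxrow_mxcol mulmx_suml summxE.
have e2 : (\mxrow_i (x i)^t* *m \mxcol_i (z i *: B i) *m y') 0 0 =
    \sum_i form (x i) (B i) y' * z i.
  rewrite mul_mxrow_mxcol mulmx_suml summxE; apply: eq_bigr => i _.
  by rewrite -scalemxAr -scalemxAl entryZ mulrC.
have e3 : (y^t* *m \mxrow_i (B i)^t* *m \mxcol_i x i) 0 0 =
    \sum_i form y ((B i)^t*) (x i).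
  by rewrite mul_mxrow mul_mxrow_mxcol summxE.
have e4 : (y'^t* *m \mxrow_i (z i *: B i)^t* *m \mxcol_i x i) 0 0 =
    \sum_i form y' ((B i)^t*) (x i) * (z i)^*.
  rewrite mul_mxrow mul_mxrow_mxcol summxE; apply: eq_bigr => i _.
  by rewrite adjZ -scalemxAr -scalemxAl entryZ mulrC.
rewrite e1 e2 e3 e4.
have arrange (p a1 a2 b1 c1 c2 b2 d1 d2 f1 f2 g1 g2 : R[i]) :
    p + (a1 + a2) + (b1 + (c1 + c2) + (b2 + (d1 + d2) + (f1 + f2 + (g1 + g2)))) =
    p + a1 + a2 + b1 + b2 + (c1 + c2 + f1 + f2) + (d1 + d2 + g1 + g2) by ring.
exact: arrange.
Qed.

(** Completing the squares in [v] and [v'] uses up y^* X X^* y and y'^* X X^* y', which turns the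
    diagonal blocks I into the Pick entries I - X X^* at the indices of f(0) and f'(0). *)
Lemma pick_ext_form (x : 'I_n -> 'cV[R[i]]_k) (y y' v v' : 'cV[R[i]]_k) :
  let u := col_mx (\mxcol_i x i) (col_mx y (col_mx y' (col_mx v v'))) in
  (u^t* *m pick_ext_mx z W X *m u) 0 0 =
    \sum_a \sum_b ((xs x y y' a)^t* *m (1%:M - Ws a *m (Ws b)^t*) *m xs x y y' b) 0 0
       * pick_kernel z a b
    + (sqn (v + X^t* *m y) + sqn (v' + X^t* *m y')).
Proof.
move=> u; rewrite /u pick_ext_blocks.
pose F a b := form (xs x y y' a) (1%:M - Ws a *m (Ws b)^t*) (xs x y y' b) * pick_kernel z a b.
rewrite -[X in _ = X + _]/(\sum_a \sum_b F a b) (sum_ord_bool F).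
have BC i : (B i)^t* = 1%:M - X *m (W i)^t* by rewrite adjB adj1 adjM adjK.
have F1 : \sum_i F (inl i) (inr false) = \sum_i form (x i) (B i) y.
  by apply: eq_bigr => i _; rewrite /F mulr1.
have F2 : \sum_i F (inr false) (inl i) = \sum_i form y ((B i)^t*) (x i).
  by apply: eq_bigr => i _; rewrite /F mulr1 BC.
have F3 : \sum_i F (inr true) (inl i) = \sum_i form y' ((B i)^t*) (x i) * (z i)^*.
  by apply: eq_bigr => i _; rewrite BC.
have F4 : F (inr true) (inr false) = 0 by rewrite /F mulr0.
have F5 : F (inr false) (inr true) = 0 by rewrite /F mulr0.
have Fyy t : form t (1%:M - X *m X^t*) t = sqn t - form t (X *m X^t*) t.
  by rewrite /form mulmxBr mulmx1 mulmxBl entryB.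
have F6 : F (inr true) (inr true) = sqn y' - form y' (X *m X^t*) y'.
  by rewrite /F mulr1 Fyy.
have F7 : F (inr false) (inr false) = sqn y - form y (X *m X^t*) y.
  by rewrite /F mulr1 Fyy.
have F8 : \sum_i \sum_j F (inl i) (inl j) = \sum_i \sum_j
  form (x i) (1%:M - W i *m (W j)^t*) (x j) * (1 - z i * (z j)^*)^-1 by [].
have F9 : \sum_i F (inl i) (inr true) = \sum_i form (x i) (B i) y' * z i by [].
clearbody F.
rewrite F1 F2 F3 F4 F5 F6 F7 F8 F9 (sqn_add_adjM v) (sqn_add_adjM v').
have arrange (p a1 a2 b1 b2 c c1 c2 c3 d d1 d2 d3 r r' : R[i]) :
    p + a1 + a2 + b1 + b2 + (c + c1 + c2 + c3) + (d + d1 + d2 + d3) =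
    p + a2 + a1 + b2 + b1 + (d - r' + 0 + (0 + (c - r))) +
      (c3 + c2 + c1 + r + (d3 + d2 + d1 + r')) by ring.
exact: arrange.
Qed.
End QuadraticForm.

Lemma unit_diskP (R : realType) (z : R[i]) : unit_disk z <-> cabs z < 1.
Proof. by rewrite /unit_disk/= -[1 : R[i]]/(1%:C%C) ltc_norm. Qed.

Lemma schur_class1_pick (R : realType) (k n : nat) (z : 'I_n -> R[i])
    (W : 'I_n -> 'M[R[i]]_k) (S : R[i] -> 'M[R[i]]_k) :
  (forall j, unit_disk (z j)) -> schur_class1 S -> (forall j, S (z j) = W j) ->
  possemidef (pick_ext_mx z W (S 0)).
Proof.
move=> zD [Shol /disk_supnorm_le1P Sc S'0] SW.
have z1 j : cabs (z j) < 1 by exact/unit_diskP.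
have Sd i j (u : R[i]) : cabs u < 1 -> cderivable (fun u => S u i j) u.
  by move=> u1; have [] := is_derive_entry i j (Shol u (iffRL (unit_diskP u) u1)).
have Sd0 i j : 'D_1 ((fun u => S u i j) : R[i]^o -> R[i]^o) 0 = 0.
  have h0 : unit_disk (0 : R[i]) by apply/unit_diskP; rewrite cabs0.
  have [_ ->] := is_derive_entry i j (Shol 0 h0).
  by rewrite -derive1E S'0 mxE.
have pos (u : 'cV_(\sum_(i < n) k + (k + (k + (k + k))))) :
    0 <= (u^t* *m pick_ext_mx z W (S 0) *m u) 0 0.
  have [x [y [y' [v [v' ->]]]]] : exists x y y' v v',
      u = col_mx (\mxcol_i x i) (col_mx y (col_mx y' (col_mx v v'))).
    exists (submxcol (usubmx u)), (usubmx (dsubmx u)), (usubmx (dsubmx (dsubmx u))).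
    exists (usubmx (dsubmx (dsubmx (dsubmx u)))), (dsubmx (dsubmx (dsubmx (dsubmx u)))).
    by rewrite submxcolK !vsubmxK.
  have -> := pick_ext_form z W (S 0) x y y' v v'.
  apply: addr_ge0; last by rewrite addr_ge0 ?sqn_ge0.
  pose xs a := match a with inl i => x i | inr false => y | inr true => y' end.
  have := open_disk_pick z1 Sd Sd0 Sc xs.
  rewrite (_ : pick_value z S = fun a => if a is inl j then W j else S 0)//.
  by apply/funext => -[j|b] //=; exact: SW.
by split=> //; exact: form_ge0_hermitian.
Qed.

(** * Gram factorizations and the lurking isometry *)

Section Gram.
Variable C : numClosedFieldType.

Lemma psd_spectral m (A : 'M[C]_m) : A \is hermsymmx ->
  (forall x : 'cV_m, 0 <= (x^t* *m A *m x) 0 0) ->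
  exists (P : 'M[C]_m) (d : 'rV[C]_m), [/\ P \is unitarymx, A = P^t* *m diag_mx d *m P &
    forall i, 0 <= d 0 i].
Proof.
move=> Ah A0; have Pu := spectral_unitarymx A.
have /hermitian_normalmx/orthomx_spectralP AE := Ah.
rewrite invmx_unitary // in AE.
exists (spectralmx A), (spectral_diag A); split => // i.
set P := spectralmx A in Pu AE *; set d := spectral_diag A in AE *.
have PP : P *m P^t* = 1%:M by exact/unitarymxP.
have PAP : P *m A *m P^t* = diag_mx d.
  by rewrite AE !mulmxA PP mul1mx -mulmxA PP mulmx1.
(* Evaluated at an eigenvector, the form returns the eigenvalue. *)
have := A0 ((row i P)^t*); rewrite adjK -[row i P *m A]row_mul.
have -> : (row i (P *m A) *m (row i P)^t*) 0 0 = (P *m A *m P^t*) i i.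
  by rewrite !mxE; apply: eq_bigr => j _; rewrite !mxE.
by rewrite PAP mxE eqxx.
Qed.

Lemma psd_factor m (A : 'M[C]_m) : A \is hermsymmx ->
  (forall x : 'cV_m, 0 <= (x^t* *m A *m x) 0 0) ->
  exists G : 'M[C]_m, A = G *m G^t*.
Proof.
move=> Ah A0; have [P [d [Pu -> d0]]] := psd_spectral Ah A0.
exists (P^t* *m diag_mx (\row_i sqrtC (d 0 i))).
rewrite adjM adjK !mulmxA -[X in _ = X *m _]mulmxA; congr (_ *m _ *m _).
rewrite tr_diag_mx map_diag_mx mulmx_diag; congr diag_mx; apply/rowP => i.
rewrite !mxE /= conj_Creal -?expr2 ?sqrtCK// ger0_real// sqrtC_ge0//.
Qed.

Lemma gram_eq0 m n (N : 'M[C]_(m, n)) : N *m N^t* = 0 -> N = 0.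
Proof.
move=> N0; apply/row_matrixP => i; rewrite row0; apply/eqP.
have : sqn ((row i N)^t*) == 0.
  rewrite /sqn adjK.
  have -> : (row i N *m (row i N)^t*) 0 0 = (N *m N^t*) i i.
    by rewrite !mxE; apply: eq_bigr => j _; rewrite !mxE.
  by rewrite N0 mxE.
by rewrite sqn_eq0 => /eqP h; rewrite -[row i N]adjK h adj0.
Qed.

(* [V = M1^* T M2] with [T] the pseudo-inverse of [M1 M1^*]; then [V^* V] is an
   orthogonal projection. *)
Lemma lurking_isometry m n (M1 M2 : 'M[C]_(m, n)) : M1 *m M1^t* = M2 *m M2^t* ->
  exists V : 'M[C]_n, M1 *m V = M2 /\ forall x : 'cV_n, sqn (V *m x) <= sqn x.
Proof.
move=> M12; have [Q Q1] : exists Q, Q = M1 *m M1^t* by exists (M1 *m M1^t*).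
have Q0 (x : 'cV_m) : 0 <= (x^t* *m Q *m x) 0 0.
  have -> : (x^t* *m Q *m x) 0 0 = sqn (M1^t* *m x).
    by rewrite /sqn adjM adjK Q1 !mulmxA.
  exact: sqn_ge0.
have [P [d [Pu QE d0]]] := psd_spectral (form_ge0_hermitian Q0) Q0.
have PP : P *m P^t* = 1%:M by exact/unitarymxP.
(* Since the inverse of 0 is 0 by convention, entrywise inversion gives the pseudo-inverse even for
   singular [Q]. *)
pose T := P^t* *m diag_mx (map_mx GRing.inv d) *m P.
have diagd : diag_mx d *m diag_mx (map_mx GRing.inv d) *m diag_mx d = diag_mx d.
  rewrite !mulmx_diag; congr diag_mx; apply/rowP => i; rewrite !mxE.
  by have [->|di] := eqVneq (d 0 i) 0; [rewrite mulr0|rewrite divff// mul1r].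
have diagd' : diag_mx (map_mx GRing.inv d) *m diag_mx d *m
    diag_mx (map_mx GRing.inv d) = diag_mx (map_mx GRing.inv d).
  rewrite !mulmx_diag; congr diag_mx; apply/rowP => i; rewrite !mxE.
  by have [->|di] := eqVneq (d 0 i) 0; [rewrite invr0 mulr0|rewrite mulVf// mul1r].
have cP (a b : 'M[C]_m) : (P^t* *m a *m P) *m (P^t* *m b *m P) = P^t* *m (a *m b) *m P.
  by rewrite !mulmxA; congr (_ *m _ *m _); rewrite -mulmxA PP mulmx1.
have QTQ : Q *m T *m Q = Q by rewrite QE /T !cP diagd.
have TQT : T *m Q *m T = T by rewrite QE /T !cP diagd'.
have Th : T^t* = T.
  rewrite /T !adjM adjK !mulmxA; congr (_ *m _ *m _).
  rewrite tr_diag_mx map_diag_mx; congr diag_mx; apply/rowP => i.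
  by rewrite !mxE /= conj_Creal// rpredV ger0_real.
(* The defect N = (1 - Q T) M2 satisfies N N^* = 0, because M2 M2^* = Q and (1 - Q T) Q = 0. *)
clearbody T; have M1V : Q *m T *m M2 = M2.
  apply/eqP; rewrite eq_sym -subr_eq0; apply/eqP/gram_eq0.
  rewrite -[X in X - _]mul1mx -mulmxBl adjM mulmxA -[_ *m M2 *m _]mulmxA -M12 -Q1.
  by rewrite [_ *m Q]mulmxBl mul1mx QTQ subrr mul0mx.
pose V := M1^t* *m T *m M2; exists V; split.
  by rewrite /V !mulmxA -Q1 M1V.
pose F := M2^t* *m T *m M2.
have VV : V^t* *m V = F.
  rewrite /V !adjM adjK Th /F -[in RHS]TQT Q1 !mulmxA.
  by [].
have FF : F *m F = F.
  rewrite /F !mulmxA -[_ *m T *m M2 *m _]mulmxA -M12 -Q1.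
  by rewrite -[M2^t* *m T *m Q]mulmxA -[M2^t* *m _ *m T]mulmxA TQT.
have Fh : F^t* = F by rewrite /F !adjM adjK Th mulmxA.
clearbody F V; move=> x; rewrite -subr_ge0.
(* Pythagoras for the orthogonal projection F = V^* V. *)
have -> : sqn x - sqn (V *m x) = sqn (x - F *m x).
  rewrite /sqn adjB !adjM Fh mulmxBl !mulmxBr -!mulmxA [V^t* *m _]mulmxA VV.
  rewrite [F *m (F *m x)]mulmxA FF subrr subr0 entryB.
  by [].
exact: sqn_ge0.
Qed.

End Gram.

(** * Transfer functions and sufficiency *)

Section DeterminantDerivable.
Context {K : numFieldType}.

Lemma cderive_addl (c : K) (f : K -> K) (z : K) : cderivable f z ->
  'D_1 ((fun x => c + f x) : K^o -> K^o) z = 'D_1 (f : K^o -> K^o) z.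
Proof.
move=> df; have := @deriveD K K^o K^o (cst c) f z 1 (@cderivable_cst K c z) df.
by rewrite derive_cst add0r.
Qed.

Lemma det_cderivable m (M : K -> 'M[K]_m) (z : K) :
  (forall i j, cderivable (fun t => M t i j) z) -> cderivable (fun t => \det (M t)) z.
Proof.
move=> Md; apply: cderivable_sum => s.
apply: cderivableM; first exact: cderivable_cst.
by apply: cderivable_prod => i; exact: Md.
Qed.

Lemma adj_cderivable m (M : K -> 'M[K]_m) (z : K) i j :
  (forall i j, cderivable (fun t => M t i j) z) -> cderivable (fun t => (\adj (M t)) i j) z.
Proof.
move=> Md.
have -> : (fun t => (\adj (M t)) i j) =
   (fun t => (-1) ^+ (j + i) * \det (row' j (col' i (M t)))).
  by apply/funext => t; rewrite mxE.
apply: cderivableM; first exact: cderivable_cst.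
apply: det_cderivable => a b.
have -> : (fun t => row' j (col' i (M t)) a b) = (fun t => M t (lift j a) (lift i b)).
  by apply/funext => t; rewrite !mxE.
exact: Md.
Qed.

Lemma mulmx_cderivable m n p (M : K -> 'M[K]_(m, n)) (N : K -> 'M[K]_(n, p)) (z : K) i j :
  (forall i j, cderivable (fun t => M t i j) z) ->
  (forall i j, cderivable (fun t => N t i j) z) ->
  cderivable (fun t => (M t *m N t) i j) z.
Proof.
move=> Md Nd.
have -> : (fun t => (M t *m N t) i j) = (fun t => \sum_l M t i l * N t l j).
  by apply/funext => t; rewrite mxE.
by apply: cderivable_sum => l; exact: cderivableM.
Qed.

End DeterminantDerivable.

Section Realization.
Variables (R : realType) (N k : nat) (V : 'M[R[i]]_(N + k)).
Hypothesis V_contr : forall x : 'cV_(N + k), sqn (V *m x) <= sqn x.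
Implicit Types zeta : R[i].

Let A := ulsubmx V.
Let B := ursubmx V.
Let C := dlsubmx V.
Let D := drsubmx V.

Definition pencil zeta : 'M[R[i]]_N := 1%:M - zeta *: A.

(** The adjugate formula exhibits the entries as quotients of polynomials in [zeta], so their
    differentiability reduces to that of determinants. *)
Definition resolvent zeta : 'M[R[i]]_N :=
  (\det (pencil zeta))^-1 *: \adj (pencil zeta).

Definition transfer zeta : 'M[R[i]]_k := D + zeta *: (C *m resolvent zeta *m B).

Let VE (x : 'cV_N) (u : 'cV_k) :
  V *m col_mx x u = col_mx (A *m x + B *m u) (C *m x + D *m u).
Proof. by rewrite -{1}[V]submxK mul_block_col. Qed.

Lemma sqn_col_mx m n (x : 'cV[R[i]]_m) (y : 'cV[R[i]]_n) :
  sqn (col_mx x y) = sqn x + sqn y.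
Proof. by rewrite /sqn tr_col_mx map_row_mx mul_row_col entryD. Qed.

Lemma sqnZ m (a : R[i]) (x : 'cV[R[i]]_m) : sqn (a *: x) = `|a| ^+ 2 * sqn x.
Proof. by rewrite /sqn adjZ -scalemxAl -scalemxAr scalerA entryZ normCKC. Qed.

Let A_contr (x : 'cV_N) : sqn (A *m x) <= sqn x.
Proof.
have := V_contr (col_mx x 0); rewrite VE !mulmx0 !addr0 !sqn_col_mx.
have -> : sqn (0 : 'cV[R[i]]_k) = 0 by apply/eqP; rewrite sqn_eq0.
rewrite addr0; apply: le_trans.
by rewrite lerDl sqn_ge0.
Qed.

Let norm2_lt1 zeta : cabs zeta < 1 -> `|zeta| ^+ 2 < 1.
Proof.
move=> z1; rewrite expr_lt1// -[1]/(1%:C%C) ltc_norm//.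
Qed.

(** A null vector satisfies x = zeta A x, so its norm is at most |zeta| times itself. The transpose
    appears because [det0P] yields a left null vector. *)
Lemma det_pencil_neq0 zeta : cabs zeta < 1 -> \det (pencil zeta) != 0.
Proof.
move=> z1; apply/negP; rewrite -det_tr => /det0P[v v0 vP].
pose x := v^T; have x0 : x != 0 by rewrite trmx_eq0.
have xE : x = zeta *: (A *m x).
  have : pencil zeta *m x = 0 by rewrite -[pencil zeta]trmxK -trmx_mul vP trmx0.
  by rewrite /pencil mulmxBl mul1mx -scalemxAl => /eqP; rewrite subr_eq0 => /eqP.
have sx : 0 < sqn x by rewrite lt_neqAle eq_sym sqn_eq0 x0 sqn_ge0.
have : sqn x <= `|zeta| ^+ 2 * sqn x.
  by rewrite {1}xE sqnZ ler_wpM2l// exprn_ge0.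
have lt1 : `|zeta| ^+ 2 * sqn x < sqn x by rewrite gtr_pMl// norm2_lt1.
by rewrite (lt_geF lt1).
Qed.

Lemma resolventK zeta : cabs zeta < 1 ->
  pencil zeta *m resolvent zeta = 1%:M.
Proof.
move=> /det_pencil_neq0 d0; rewrite /resolvent.
by rewrite -scalemxAr mul_mx_adj -mul_scalar_mx -scalar_mxM mulVf.
Qed.

(** Energy balance: V maps (zeta xi, u) to (xi, S(zeta) u), where xi is the state, so |xi|^2 +
    |S(zeta) u|^2 <= |zeta|^2 |xi|^2 + |u|^2. *)
Lemma transfer_contr zeta (u : 'cV_k) : cabs zeta < 1 -> sqn (transfer zeta *m u) <= sqn u.
Proof.
move=> z1; pose xi := resolvent zeta *m B *m u.
have xiE : A *m (zeta *: xi) + B *m u = xi.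
  have : pencil zeta *m xi = B *m u.
    by rewrite /xi !mulmxA (resolventK z1) mul1mx.
  by rewrite /pencil mulmxBl mul1mx -scalemxAl -scalemxAr => <-; rewrite addrC subrK.
have := V_contr (col_mx (zeta *: xi) u).
have TE : C *m (zeta *: xi) + D *m u = transfer zeta *m u.
  by rewrite /transfer mulmxDl addrC -scalemxAl -scalemxAr /xi !mulmxA.
rewrite VE xiE TE !sqn_col_mx sqnZ => h.
rewrite -(lerD2l (sqn xi)) (le_trans h)// lerD2r ler_piMl ?sqn_ge0//.
exact/ltW/norm2_lt1.
Qed.

(** The two equations say that the row (zeta H, 1) times V is (H, W). The first forces H = C (1 -
    zeta A)^-1, and then the second is the transfer function. *)
Lemma transfer_interp (W : 'M[R[i]]_k) (H : 'M[R[i]]_(k, N)) zeta : cabs zeta < 1 ->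
  zeta *: (H *m A) + C = H -> zeta *: (H *m B) + D = W -> transfer zeta = W.
Proof.
move=> z1 HA <-; have HC : H *m pencil zeta = C.
  by rewrite /pencil mulmxBr mulmx1 -scalemxAr -{1}HA addrC addKr.
by rewrite /transfer -HC -(mulmxA H) (resolventK z1) mulmx1 addrC.
Qed.

Let pencil_cderivable zeta i j : cderivable (fun t => pencil t i j) zeta.
Proof.
have -> : (fun t => pencil t i j) = (fun t => (1%:M : 'M[R[i]]_N) i j - t * A i j).
  by apply/funext => t; rewrite entryB entryZ.
apply: cderivableB; first exact: cderivable_cst.
by apply: cderivableM; [exact: cderivable_id|exact: cderivable_cst].
Qed.

Let resolvent_cderivable zeta i j : cabs zeta < 1 ->
  cderivable (fun t => resolvent t i j) zeta.
Proof.
move=> z1.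
have -> : (fun t => resolvent t i j) =
    (fun t => (\det (pencil t))^-1 * (\adj (pencil t)) i j).
  by apply/funext => t; rewrite entryZ.
apply: cderivableM; last exact: adj_cderivable.
apply: cderivableV; first exact: det_pencil_neq0.
exact: det_cderivable.
Qed.

Let core_cderivable zeta i j : cabs zeta < 1 ->
  cderivable (fun t => (C *m resolvent t *m B) i j) zeta.
Proof.
move=> z1; apply: mulmx_cderivable => a b; last exact: cderivable_cst.
apply: mulmx_cderivable => c d; first exact: cderivable_cst.
exact: resolvent_cderivable.
Qed.

Let transferE i j : (fun t => transfer t i j) =
  (fun t => D i j + t * (C *m resolvent t *m B) i j).
Proof. by apply/funext => t; rewrite entryD entryZ. Qed.

Lemma transfer_cderivable zeta i j : cabs zeta < 1 ->
  cderivable (fun t => transfer t i j) zeta.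
Proof.
move=> z1; rewrite transferE.
apply: cderivableD; first exact: cderivable_cst.
by apply: cderivableM; [exact: cderivable_id|exact: core_cderivable].
Qed.

(** The derivative of zeta g(zeta) at 0 is g(0), which here is C B because the resolvent at 0 is the
    identity. *)
Lemma transfer_cderive0 i j : C *m B = 0 ->
  'D_1 ((fun t => transfer t i j) : R[i]^o -> R[i]^o) 0 = 0.
Proof.
move=> CB; rewrite transferE.
have c0 : cabs (0 : R[i]) < 1 by rewrite cabs0.
have d1 := @core_cderivable 0 i j c0.
have d2 := @cderivable_id R[i] 0.
rewrite (cderive_addl (D i j) (cderivableM d2 d1)) (cderiveM d2 d1) mul0r add0r.
have -> : C *m resolvent 0 *m B = 0.
  rewrite /resolvent /pencil scale0r subr0 det1 invr1 scale1r.
  have := mul_mx_adj (1%:M : 'M[R[i]]_N); rewrite mul1mx det1 => ->.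
  by rewrite mulmx1.
by rewrite mxE mul0r.
Qed.

Lemma transfer_schur_class1 : C *m B = 0 -> schur_class1 transfer.
Proof.
move=> CB.
have tr_der zeta : unit_disk zeta -> is_derive (zeta : R[i]^o) 1
    (transfer : R[i]^o -> 'M[R[i]]_k)
    (\matrix_(i, j) 'D_1 ((fun t => transfer t i j) : R[i]^o -> R[i]^o) zeta).
  move=> /unit_diskP z1; apply: is_derive_mx => i j; rewrite mxE.
  exact/derivableP/transfer_cderivable.
have d0 : unit_disk (0 : R[i]) by apply/unit_diskP; rewrite cabs0.
split.
- by move=> zeta /tr_der [].
- by apply/disk_supnorm_le1P => zeta z1 x; exact: transfer_contr.
- rewrite derive1E; have [_ ->] := tr_der _ d0.
  by apply/matrixP => i j; rewrite !mxE transfer_cderive0.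
Qed.

End Realization.

Section GramBlocks.
Variable C : numClosedFieldType.

Lemma row_gram m p n1 n2 (a : 'M[C]_(m, n1)) (b : 'M_(m, n2))
    (c : 'M_(p, n1)) (d : 'M_(p, n2)) :
  row_mx a b *m (row_mx c d)^t* = a *m c^t* + b *m d^t*.
Proof. by rewrite tr_row_mx map_col_mx mul_row_col. Qed.

Lemma col_gram m1 m2 n (r s : 'M[C]_(m1, n)) (r' s' : 'M_(m2, n)) :
  r *m r^t* = s *m s^t* -> r *m r'^t* = s *m s'^t* -> r' *m r'^t* = s' *m s'^t* ->
  col_mx r r' *m (col_mx r r')^t* = col_mx s s' *m (col_mx s s')^t*.
Proof.
move=> rr rr' r'r'; have r'r : r' *m r^t* = s' *m s^t*.
  by rewrite -[r']adjK -[s']adjK -!adjM rr'.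
by rewrite !tr_col_mx !map_row_mx !mul_col_mx !mul_mx_row rr rr' r'r r'r'.
Qed.

Lemma col_gram3 m1 m2 m3 n (r1 s1 : 'M[C]_(m1, n)) (r2 s2 : 'M_(m2, n))
    (r3 s3 : 'M_(m3, n)) :
  r1 *m r1^t* = s1 *m s1^t* -> r1 *m r2^t* = s1 *m s2^t* ->
  r1 *m r3^t* = s1 *m s3^t* -> r2 *m r2^t* = s2 *m s2^t* ->
  r2 *m r3^t* = s2 *m s3^t* -> r3 *m r3^t* = s3 *m s3^t* ->
  col_mx r1 (col_mx r2 r3) *m (col_mx r1 (col_mx r2 r3))^t* =
  col_mx s1 (col_mx s2 s3) *m (col_mx s1 (col_mx s2 s3))^t*.
Proof.
move=> h11 h12 h13 h22 h23 h33; apply: col_gram => //; last exact: col_gram.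
by rewrite !tr_col_mx !map_row_mx !mul_mx_row h12 h13.
Qed.

Lemma stein_entry m (c : C) (U : 'M[C]_m) : 1 - c != 0 ->
  c *: ((1 - c)^-1 *: (1%:M - U)) + 1%:M = (1 - c)^-1 *: (1%:M - U) + U.
Proof. by move=> c0; apply/matrixP => i j; rewrite !mxE; field. Qed.
End GramBlocks.

(** * From a Gram factor of the extended matrix to an interpolant *)

Section Sufficiency.
Variables (R : realType) (k n : nat).
Variables (z : 'I_n -> R[i]) (W : 'I_n -> 'M[R[i]]_k) (X : 'M[R[i]]_k).
Hypothesis z1 : forall j, cabs (z j) < 1.

Local Notation E := (Emx R k n).
Local Notation Z := (Zmx k z).
Local Notation Wc := (Wmx W).

(** The Stein equation P - Z P Z^* = E E^* - W W^* with P factored. Its (i, j) block is P_ij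
    multiplied by its denominator 1 - z_i conj(z_j), which is nonzero on the disk. *)
Lemma pick_stein m (H : 'M[R[i]]_(\sum_(i < n) k, m)) : pick_mx z W = H *m H^t* ->
  (Z *m H) *m (Z *m H)^t* + E *m E^t* = H *m H^t* + Wc *m Wc^t*.
Proof.
rewrite -[H]submxcolK; set D := submxcol H => PH.
rewrite Zmx_mxcol /Emx /Wmx !adj_mxcol !mul_mxcol_mxrow -!mxblockD.
apply: eq_mxblock => i j.
move: PH; rewrite /pick_mx adj_mxcol mul_mxcol_mxrow => /eq_mxblockP/(_ i j) Dij.
have K0 := szego_den_neq0 (z1 j) (ltW (z1 i)).
rewrite adjZ -scalemxAl -scalemxAr scalerA adj1 mulmx1 -Dij.
exact: stein_entry.
Qed.

Lemma pick_ext_realizable : possemidef (pick_ext_mx z W X) ->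
  exists S, schur_class1 S /\ forall j, S (z j) = W j.
Proof.
move=> [Ah A0]; have [G GE] := psd_factor Ah A0.
move: GE; rewrite -[G]vsubmxK -[dsubmx G]vsubmxK -[dsubmx (dsubmx G)]vsubmxK.
rewrite -[dsubmx (dsubmx (dsubmx G))]vsubmxK.
set H := usubmx G; set g0 := usubmx (dsubmx G); set g1 := usubmx (dsubmx (dsubmx G)).
set y0 := usubmx (dsubmx (dsubmx (dsubmx G))).
set y1 := dsubmx (dsubmx (dsubmx (dsubmx G))).
clearbody H g0 g1 y0 y1.
rewrite /pick_ext_mx /row_mx5 !tr_col_mx !map_row_mx !mul_col_mx !mul_mx_row.
move=> /eq_col_mx[/eq_row_mx[HH /eq_row_mx[Hg0 /eq_row_mx[Hg1 /eq_row_mx[Hy0 Hy1]]]]].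
move=> /eq_col_mx[/eq_row_mx[_ /eq_row_mx[g0g0 /eq_row_mx[g0g1 /eq_row_mx[g0y0 g0y1]]]]].
move=> /eq_col_mx[/eq_row_mx[_ /eq_row_mx[_ /eq_row_mx[g1g1 /eq_row_mx[g1y0 g1y1]]]]].
move=> /eq_col_mx[/eq_row_mx[_ /eq_row_mx[y0g0 /eq_row_mx[y0g1 /eq_row_mx[y0y0 y0y1]]]]].
move=> /eq_row_mx[_ /eq_row_mx[y1g0 /eq_row_mx[y1g1 /eq_row_mx[_ y1y1]]]].
(* Schur complement of the two trailing identity blocks: [h0] and [h1] play the
   roles of [H(0)] and [H'(0)] for [H(z) = C (1 - z A)^-1]. *)
pose h0 := g0 - X *m y0; pose h1 := g1 - X *m y1.
have Hh0 : H *m h0^t* = E - Wc *m X^t*.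
  by rewrite /h0 adjB adjM mulmxBr mulmxA -Hy0 mul0mx subr0 Hg0.
have Hh1 : H *m h1^t* = Z *m (E - Wc *m X^t*).
  by rewrite /h1 adjB adjM mulmxBr mulmxA -Hy1 mul0mx subr0 Hg1.
have h0h0 : h0 *m h0^t* = 1%:M - X *m X^t*.
  rewrite /h0 adjB adjM mulmxBr !mulmxBl !mulmxA -(mulmxA X y0) -g0g0 -g0y0 -y0g0.
  by rewrite -(mulmxA X) -y0y0 mulmx1 subrr subr0.
have h1h1 : h1 *m h1^t* = 1%:M - X *m X^t*.
  rewrite /h1 adjB adjM mulmxBr !mulmxBl !mulmxA -(mulmxA X y1) -g1g1 -g1y1 -y1g1.
  by rewrite -(mulmxA X) -y1y1 mulmx1 subrr subr0.
have h0h1 : h0 *m h1^t* = 0.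
  rewrite /h0 /h1 adjB adjM mulmxBr !mulmxBl !mulmxA -(mulmxA X y0) -g0g1 -g0y1 -y0g1.
  by rewrite -(mulmxA X) -y0y1 !mulmx0 !mul0mx !subr0.
clearbody h0 h1.
pose M1 := col_mx (row_mx (Z *m H) E) (col_mx (row_mx 0 1%:M) (row_mx h0 (0 : 'M_k))).
pose M2 := col_mx (row_mx H Wc) (col_mx (row_mx h0 X) (row_mx h1 (0 : 'M_k))).
(* The first identity is the Stein equation; the other five are the blocks, computed above, of the
   Schur complement that involve [h0] or [h1]. *)
have M12 : M1 *m M1^t* = M2 *m M2^t*.
  apply: col_gram3; rewrite !row_gram ?adj0 ?adj1 ?mulmx0 ?mul0mx ?mulmx1 ?add0r ?addr0.
  - exact: pick_stein.
  - by rewrite Hh0 subrK.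
  - by rewrite -mulmxA Hh0 Hh1.
  - by rewrite h0h0 subrK.
  - by rewrite h0h1.
  - by rewrite h0h0 h1h1.
have [V [M1V Vc]] := lurking_isometry M12.
move: M1V; rewrite /M1 /M2 !mul_col_mx -{1 2 3}[V]submxK !mul_row_block.
rewrite !mul0mx !mul1mx !addr0 !add0r.
(* The row (0, 1) reads off the lower blocks of V, so C = [h0]; the row ([h0], 0) has second image
   component 0, so [h0] B = 0. *)
move=> /eq_col_mx[/eq_row_mx[HA HB] /eq_col_mx[/eq_row_mx[Ch0 _] /eq_row_mx[_ hB]]].
exists (transfer V); split; first by apply: transfer_schur_class1; rewrite // Ch0.
move=> j; apply: (transfer_interp Vc (H := submxcol H j)) => //.
  have /mxcolP/(_ j) := HA.
  rewrite -{1}[H]submxcolK Zmx_mxcol !mxcol_mul submxcolD !mxcolK mul1mx.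
  by rewrite -scalemxAl.
have /mxcolP/(_ j) := HB.
rewrite -{1}[H]submxcolK Zmx_mxcol !mxcol_mul submxcolD !mxcolK mul1mx.
by rewrite -scalemxAl.
Qed.

End Sufficiency.

Theorem theorem1p4 (R : realType) (k n : nat) (hk : (1 <= k)%N) (hn : (1 <= n)%N)
    (z : 'I_n -> R[i]) (W : 'I_n -> 'M[R[i]]_k)
    (z_inj : injective z) (z_neq0 : forall j, z j != 0)
    (z_disk : forall j, unit_disk (z j)) :
  (exists S : R[i] -> 'M[R[i]]_k,
      schur_class1 S /\ forall j, S (z j) = W j)
  <->
  (exists X : 'M[R[i]]_k, possemidef (pick_ext_mx z W X)).
Proof.
split=> [[S [Sc SW]]|[X PX]].
  by exists (S 0); exact: schur_class1_pick.
by apply: pick_ext_realizable PX => j; exact/unit_diskP.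
Qed.
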